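(* Let $K\subset\mathbb{R}^2$ be a $C^2_+$ planar convex body and $\alpha\in(0,1)$. Then $$W_\alpha(K)\ge W_\alpha(B_1)\left[\frac{\operatorname{Per}(K)}{2\pi}\right]^{1-\alpha}.$$ Moreover, if $K=\overline{B}_1$, then equality holds.
   Context: A planar convex body is a compact convex subset of $\mathbb{R}^2$ with nonempty interior. A simple closed plane curve is positively oriented if its interior lies to the left as one moves in the direction of increasing parameter. For a plane curve $\gamma$ parametrized by arclength, its signed curvature is $\kappa_\gamma:=\det(\gamma',\gamma'')$. A planar convex body $K$ is called $C^2_+$ if $\partial K$ admits a positively oriented $C^2$ arclength parametrization whose signed curvature is positive. For a $C^2_+$ planar convex body $K$ and $\alpha\in(0,1)$, $$W_\alpha(K):=\int_{\partial K}\int_{\partial K}\frac{(y-x)\cdot\nu_K(y)}{|x-y|^{2+\alpha}}\,d\mathcal{H}^1(y)\,d\mathcal{H}^1(x),$$ where $\nu_K$ is the outward unit normal along $\partial K$ and $\mathcal{H}^1$ is one-dimensional Hausdorff measure. $B_1$ is the unit disk centered at the origin, $\overline{B}_1$ its closure, and $W_\alpha(B_1)$ means $W_\alpha(\overline{B}_1)$. $\operatorname{Per}(K)$ is the perimeter of $K$, equal to $\mathcal{H}^1(\partial K)$. *)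

(* Defs.v *)
From HB Require Import structures.
From mathcomp Require Import all_boot all_order all_algebra.
From mathcomp Require Import all_classical all_reals all_analysis.
Set Implicit Arguments.
Unset Strict Implicit.
Unset Printing Implicit Defensive.
Import Order.TTheory GRing.Theory Num.Theory.
Import numFieldNormedType.Exports.

Local Open Scope classical_set_scope.
Local Open Scope ring_scope.

Section plane.
Context {R : realType}.
Local Notation plane := (R * R)%type.
Implicit Types (u v x y z p : plane) (A K : set plane) (gamma : R -> plane).

(* The library norm on [R * R] is the sup norm: it has the right topology and
   bounded sets, but all metric quantities below use [enorm] instead. *)
Definition dot u v : R := u.1 * v.1 + u.2 * v.2.
Definition enorm v : R := Num.sqrt (dot v v).
Definition det2 u v : R := u.1 * v.2 - u.2 * v.1.
(* counterclockwise rotation by a right angle *)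
Definition rot90 v : plane := (- v.2, v.1).

Definition boundary A : set plane := closure A `\` interior A.

(* Euclidean diameter, with [diam set0 = 0]. *)
Definition diam A : \bar R :=
  maxe 0%E (ereal_sup [set (enorm (p.1 - p.2))%:E | p in A `*` A]).

Definition hausdorff1_delta (delta : R) A : \bar R :=
  ereal_inf [set (\sum_(0 <= n <oo) diam (U n))%E | U in
    [set U : (set plane)^nat | A `<=` \bigcup_n U n /\
      forall n, (diam (U n) <= delta%:E)%E]].

(* One-dimensional Hausdorff (outer) measure. Borel sets are measurable for it,
   so its integrals below are taken over the product (i.e. Borel)
   sigma-algebra of [R * R]. *)
Definition hausdorff1 A : \bar R :=
  ereal_sup [set hausdorff1_delta delta A | delta in [set d : R | 0 < d]].

Definition planar_convex_body K : Prop :=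
  [/\ compact K, convex_set (K : set (convex_lmodType plane)) &
      interior K !=set0].

(* The interior of a closed curve, in the sense of Jordan's theorem: the union
   of the bounded connected components of the complement of its image. *)
Definition curve_interior gamma : set plane :=
  [set p | ~ range gamma p /\
     bounded_set (connected_component (~` range gamma) p)].

(* A closed curve of length [L] is represented by its [L]-periodic extension
   to the real line, so that regularity also holds at the base point. *)
Definition simple_closed gamma (L : R) : Prop :=
  [/\ 0 < L, (forall t, gamma (t + L) = gamma t) &
      {in `[0, L[ &, injective gamma}].

Definition positively_oriented gamma : Prop :=
  forall t, \forall e \near 0^'+,
    curve_interior gamma (gamma t + e *: rot90 (derive1 gamma t)).

Definition C2_curve gamma : Prop :=
  [/\ (forall t : R, derivable gamma t 1),
      (forall t : R, derivable (derive1 gamma) t 1) &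
      continuous (derive1n 2 gamma)].

Definition arclength gamma : Prop := forall t, enorm (derive1 gamma t) = 1.

Definition signed_curvature gamma (t : R) : R :=
  det2 (derive1 gamma t) (derive1n 2 gamma t).

Definition C2plus K : Prop :=
  planar_convex_body K /\
  exists gamma (L : R),
    [/\ simple_closed gamma L, range gamma = boundary K, C2_curve gamma,
        arclength gamma & positively_oriented gamma /\
        forall t, 0 < signed_curvature gamma t].

Definition is_outward_unit_normal K y u : Prop :=
  enorm u = 1 /\ forall z, K z -> dot (z - y) u <= 0.

(* Only meaningful where the outward unit normal exists and is unique, in
   particular at all boundary points of a [C2plus] body. *)
Definition outward_normal K y : plane := get (is_outward_unit_normal K y).

Definition Per K : \bar R := hausdorff1 (boundary K).

(* The integrand is nonnegative for convex [K]; on the diagonal, where it is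
   undefined in the usual formula, it evaluates to 0 (a null set). *)
Definition W (alpha : R) K : \bar R :=
  (\int[hausdorff1]_(x in boundary K) \int[hausdorff1]_(y in boundary K)
     (dot (y - x) (outward_normal K y) / enorm (x - y) `^ (2 + alpha))%:E)%E.

Definition unit_disk : set plane := [set p | enorm p < 1].

End plane.
Arguments unit_disk : clear implicits.

(* Main.v *)
Require Import Defs.
From HB Require Import structures.
From mathcomp Require Import all_boot all_order all_algebra.
From mathcomp Require Import all_classical all_reals all_analysis.
From mathcomp Require Import measurable_realfun ring lra.
Import Order.TTheory GRing.Theory Num.Theory.
Import numFieldNormedType.Exports.

Local Open Scope classical_set_scope.
Local Open Scope ring_scope.

(** The energy measures how the boundary turns around itself. Run through the
    boundary of [K] at constant speed [L], with period 1, as [P], and let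
    [T = (cos Phi, sin Phi)] be its unit tangent. The integrand of [W] is the
    angular speed of [P t] seen from [P s], times [|P s - P t| ^ (- alpha)].
    Symmetrizing in [s] and [t] and integrating along the diagonals
    [t = s + v] of the torus gives

      [W = (L / 2) * int_0^1 (oint_(z_v) r ^ (- alpha) d omega) dv],

    where [z_v x = P (x + v) - P x] is a closed curve with polar coordinates
    [r] and [omega].

    For fixed [v] this curve winds once around the origin, because its direction
    stays within a half-turn of [T], and [T] turns once. Let
    [a = (L / pi) * sin (pi * v)] be the chord of the circle of length [L] for
    the gap [v]. The tangent line at [a] of the convex function
    [r ^ (- alpha)] bounds the inner integral from below by
    [2 * pi * (1 + alpha) * a ^ (- alpha) - alpha * a ^ (- alpha - 1) * l],
    where [l], the integral of [r d omega], is at most the length of [z_v].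
    The speed of [z_v] is [2 * L * sin beta] with
    [beta = (Phi (x + v) - Phi x) / 2], whose mean is [pi * v]; as the sine is
    concave on [[0, pi]], that length is at most
    [2 * L * sin (pi * v) = 2 * pi * a]. Hence the inner integral is at least
    [2 * pi * a ^ (- alpha)] ([fixed_gap_bound]), which is its value for the
    circle of length [L], and integrating in [v] gives the inequality
    ([double_integral_wkernel_ge], [W_disk]).

    Two things connect this computation with the definitions. Hausdorff measure
    on the curve is the image of [L] times Lebesgue measure on [[0, 1[]
    ([integral_hausdorff1_curve]): the upper bound holds because [P] is
    Lipschitz, the lower one because chords are asymptotically as long as arcs.
    Convexity of [K] and positivity of the curvature show that the body lies
    strictly to the left of each tangent line ([tangent_dist_gt0_convex]), that
    the tangent makes a single turn ([total_turning]), and that the outward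
    normal is the tangent turned clockwise ([outward_normal_convex]). *)

Set Implicit Arguments.
Unset Strict Implicit.
Unset Printing Implicit Defensive.

(** * Calculus on the line *)

Section calculus.
Context {R : realType}.
Implicit Types (f g F : R -> R) (x a b : R).

Lemma is_derive_add f g x a b : is_derive x 1 f a -> is_derive x 1 g b ->
  is_derive x 1 (fun y => f y + g y) (a + b).
Proof. by move=> ? ?; exact: is_deriveD. Qed.

Lemma is_derive_sub f g x a b : is_derive x 1 f a -> is_derive x 1 g b ->
  is_derive x 1 (fun y => f y - g y) (a - b).
Proof. by move=> ? ?; exact: is_deriveB. Qed.

Lemma is_derive_mul f g x a b : is_derive x 1 f a -> is_derive x 1 g b ->
  is_derive x 1 (fun y => f y * g y) (a * g x + f x * b).
Proof.
move=> df dg; apply: (is_derive_eq (is_deriveM df dg)).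
by rewrite /GRing.scale/= addrC mulrC.
Qed.

Lemma is_derive_inv f x a : f x != 0 -> is_derive x 1 f a ->
  is_derive x 1 (fun y => (f y)^-1) (- a / f x ^+ 2).
Proof.
move=> f0 df; apply: (is_derive_eq (is_deriveV f0 df)).
by rewrite /GRing.scale/= mulNr mulrC mulNr.
Qed.

Lemma is_derive_div f g x a b : g x != 0 -> is_derive x 1 f a -> is_derive x 1 g b ->
  is_derive x 1 (fun y => f y / g y) ((a * g x - f x * b) / g x ^+ 2).
Proof.
by move=> g0 df dg; apply: (is_derive_eq (is_derive_mul df (is_derive_inv g0 dg))); field.
Qed.

Lemma is_derive_const (c : R) x : is_derive x 1 (fun _ : R => c : R) (0 : R).
Proof. exact: is_derive_cst. Qed.

Lemma is_derive_ident x : is_derive x 1 (fun y : R => y) (1 : R).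
Proof. exact: is_derive_id. Qed.

Lemma is_derive_compose f g x a b : is_derive (g x) 1 f a -> is_derive x 1 g b ->
  is_derive x 1 (fun y => f (g y)) (a * b).
Proof. by move=> ? ?; exact: is_derive1_comp. Qed.

Lemma is_derive_shift f x v a : is_derive (x + v) 1 f a ->
  is_derive x 1 (fun y => f (y + v)) a.
Proof.
move=> df; have d1 := is_derive_add (is_derive_ident x) (is_derive_const v x).
by apply: (is_derive_eq (@is_derive_compose f (fun y => y + v) _ _ _ df d1)); rewrite addr0 mulr1.
Qed.

Lemma is_derive_continuous f x a : is_derive x 1 f a -> {for x, continuous f}.
Proof.
by move=> [/derivable1_diffP/differentiable_continuous].
Qed.

Lemma is_derive_within f df (a b : R) : (forall x, is_derive x 1 f (df x)) ->
  {within `[a, b], continuous f}.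
Proof.
move=> fd; apply: continuous_subspaceT => x.
exact: is_derive_continuous (fd x).
Qed.

Lemma mean_value f df a b : (forall x, is_derive x 1 f (df x)) -> a < b ->
  exists2 c, a < c < b & f b - f a = df c * (b - a).
Proof.
move=> fd ab.
have [c] := @MVT R f df a b ab (fun x _ => fd x) (is_derive_within fd).
by rewrite in_itv/= => cab E; exists c.
Qed.

Lemma is_derive_gt0_lt f df a b : (forall x, is_derive x 1 f (df x)) ->
  (forall x, a < x < b -> 0 < df x) -> a < b -> f a < f b.
Proof.
move=> fd df0 ab; have [c cab E] := mean_value fd ab.
by rewrite -subr_gt0 E mulr_gt0 ?subr_gt0// df0.
Qed.

Lemma is_derive0_const f : (forall x, is_derive x 1 f 0) -> forall x y, f x = f y.
Proof. by move=> f0 x y; exact: is_derive_0_is_cst. Qed.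

(** Integrating from [- n] gives a primitive on a half-line; these primitives
    differ by constants and are glued together. *)
Lemma antiderivative f : continuous f ->
  exists F, forall x, is_derive x 1 F (f x).
Proof.
move=> fc.
pose F (n : nat) (x : R) : R := (\int[@lebesgue_measure R]_(t in [set` Interval (BLeft (- n%:R)) (BRight x)]) f t)%R.
have dF (n : nat) x : - n%:R < x -> is_derive x 1 (F n) (f x).
  move=> nx.
  have x1 : x < x + 1 by rewrite ltrDl.
  have int_f : (@lebesgue_measure R).-integrable
      [set` Interval (BLeft (- n%:R)) (BRight (x + 1))] (EFin \o f).
    apply: continuous_compact_integrable; first exact: segment_compact.
    exact: continuous_subspaceT.
  have [|d e] := continuous_FTC1 x1 int_f _ (fc x); first by rewrite lte_fin.
  by apply: DeriveDef d _; rewrite -derive1E.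
have FF (n m : nat) x : - n%:R < x -> - m%:R < x -> (0 < n)%N -> (0 < m)%N ->
    F n x - F n 0 = F m x - F m 0.
  move=> nx mx n0 m0.
  pose D y := F n y - F m y.
  have dD (y : R) : - n%:R < y -> - m%:R < y -> is_derive y 1 D 0.
    move=> ny my; have := is_derive_sub (dF _ _ ny) (dF _ _ my).
    by rewrite subrr.
  suff : D x = D 0 by rewrite /D; lra.
  have key (u w : R) : u < w -> - n%:R < u -> - m%:R < u -> D u = D w.
    move=> uw nu mu.
    have dDi (z : R) : u <= z -> is_derive z 1 D 0.
      by move=> uz; apply: dD; exact: lt_le_trans uz.
    have [||c _ E] := @MVT R D (cst 0) u w uw.
    - by move=> z; rewrite in_itv/= => /andP[/ltW uz _]; exact: dDi.
    - apply: derivable_within_continuous => z; rewrite in_itv/= => /andP[uz _].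
      by case: (dDi _ uz).
    by move: E; rewrite /cst/= mul0r => /eqP; rewrite subr_eq0 => /eqP.
  have n0' : - n%:R < 0 :> R by rewrite oppr_lt0 ltr0n.
  have m0' : - m%:R < 0 :> R by rewrite oppr_lt0 ltr0n.
  have [x0|x0|->//] := ltgtP x 0; first exact: key.
  by apply/esym; exact: key.
pose N (x : R) := (Num.trunc `|x|).+1.
have NE (x : R) : - (N x)%:R < x.
  have := truncnS_gt `|x|; rewrite -/(N x) => h.
  by rewrite ltrNl (le_lt_trans _ h)// ler_normr lexx orbT.
exists (fun x => F (N x) x - F (N x) 0) => x.
pose m := (N x).+1.
have mx : - m%:R < x by rewrite (lt_trans _ (NE x))// ltrN2 ltr_nat.
apply: (@near_eq_is_derive _ _ _ (fun y => F m y - F m 0)).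
  have : \forall y \near x, - m%:R < y by exact: lt_nbhsr.
  by apply: filterS => y my; apply: FF.
have := is_derive_sub (dF _ _ mx) (is_derive_const (F m 0) x).
by rewrite subr0.
Qed.

(** A curve on the unit circle turning at rate [k] is the exponential of any
    antiderivative of [k] that has the right initial value. *)
Lemma angle_lift (T1 T2 k : R -> R) : continuous k ->
  (forall x, is_derive x 1 T1 (- (k x * T2 x))) ->
  (forall x, is_derive x 1 T2 (k x * T1 x)) ->
  (forall x, T1 x ^+ 2 + T2 x ^+ 2 = 1) ->
  exists2 Phi : R -> R, (forall x, is_derive x 1 Phi (k x)) &
    forall x, T1 x = cos (Phi x) /\ T2 x = sin (Phi x).
Proof.
move=> kc dT1 dT2 T12.
have [F dF] := antiderivative kc.
have [th [c0 s0]] : exists th, T1 0 = cos th /\ T2 0 = sin th.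
  have T10 : -1 <= T1 0 <= 1.
    rewrite -ler_norml -(@expr_le1 _ 2) ?normr_ge0//.
    by rewrite real_normK ?num_real// -(T12 0) lerDl sqr_ge0.
  have [_ cE] := acos_def T10.
  have : sin (acos (T1 0)) ^+ 2 = T2 0 ^+ 2.
    by have := T12 0; have := cos2Dsin2 (acos (T1 0)); rewrite cE; lra.
  move/eqP; rewrite eqf_sqr => /orP[|] /eqP E.
    by exists (acos (T1 0)).
  by exists (- acos (T1 0)); rewrite cosN sinN cE E opprK.
pose Phi x := F x - F 0 + th.
have dPhi x : is_derive x 1 Phi (k x).
  have := is_derive_add (is_derive_sub (dF x) (is_derive_const (F 0) x)) (is_derive_const th x).
  by rewrite subr0 addr0.
exists Phi => // x.
pose D y := T1 y * cos (Phi y) + T2 y * sin (Phi y).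
have D0 (y : R) : is_derive y 1 D 0.
  have dc := is_derive_compose (is_derive_cos (Phi y)) (dPhi y).
  have ds := is_derive_compose (is_derive_sin (Phi y)) (dPhi y).
  by apply: (is_derive_eq (is_derive_add (is_derive_mul (dT1 y) dc) (is_derive_mul (dT2 y) ds))); ring.
have Dx : D x = 1.
  rewrite (is_derive0_const D0 x 0) /D {1}c0 {1}s0 /Phi subrr add0r.
  by rewrite -!expr2 cos2Dsin2.
have : (T1 x - cos (Phi x)) ^+ 2 + (T2 x - sin (Phi x)) ^+ 2 = 0.
  have := T12 x; have := cos2Dsin2 (Phi x); move: Dx; rewrite /D; nra.
move=> E.
have := sqr_ge0 (T1 x - cos (Phi x)); have := sqr_ge0 (T2 x - sin (Phi x)) => e2 e1.
have /eqP : (T1 x - cos (Phi x)) ^+ 2 = 0 by apply/eqP; rewrite eq_le e1 andbT; lra.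
have /eqP : (T2 x - sin (Phi x)) ^+ 2 = 0 by apply/eqP; rewrite eq_le e2 andbT; lra.
by rewrite !sqrf_eq0 !subr_eq0 => /eqP -> /eqP ->.
Qed.

(** The integral of [g] is compared with that of the positive part of [f], so
    that [g] may have an infinite integral. *)
Lemma integral_ge_increment F f g : (forall x, is_derive x 1 F (f x)) ->
  continuous f -> measurable_fun (`[0, 1[%classic : set R) g ->
  (forall x, 0 <= g x) -> (forall x, f x <= g x) ->
  ((F 1 - F 0)%:E <= \int[@lebesgue_measure R]_(x in `[0%R, 1%R[) (g x)%:E)%E.
Proof.
move=> dF fc mg g0 fg.
have mf : measurable_fun setT f by exact: continuous_measurable_fun.
have -> : ((F 1 - F 0)%:E = \int[@lebesgue_measure R]_(x in `[0%R, 1%R]) (f x)%:E)%E.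
  apply/esym; apply: continuous_FTC2 => //.
  - exact: continuous_subspaceT.
  - split.
    + by move=> x _; case: (dF x).
    + by apply: cvg_at_right_filter; exact: is_derive_continuous (dF 0).
    + by apply: cvg_at_left_filter; exact: is_derive_continuous (dF 1).
  - by move=> x _; rewrite derive1E; case: (dF x).
rewrite -integral_itv_bndo_bndc; last first.
  by apply/measurable_EFinP; exact: measurable_funS mf.
pose fp x := Num.max (f x) 0.
apply: (@le_trans _ _ (\int[@lebesgue_measure R]_(x in `[0%R, 1%R[) (fp x)%:E)%E).
  rewrite integralE -[leRHS]sube0; apply: leeB.
    rewrite le_eqVlt; apply/orP; left; apply/eqP; apply: eq_integral => x _.
    by rewrite funeposE /fp EFin_max.
  by apply: integral_ge0 => x _; exact: funeneg_ge0.
apply: ge0_le_integral => //=.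
- by move=> x _; rewrite lee_fin le_max lexx orbT.
- apply/measurable_EFinP; apply: measurable_maxr => //.
  exact: measurable_funS mf.
- exact/measurable_EFinP.
- by move=> x _; rewrite lee_fin ge_max fg g0.
Qed.

(** The tangent line at [a] of the convex function [r `^ (- alpha)], obtained
    from the exponential and logarithmic inequalities. *)
Lemma powR_tangent (alpha a r : R) : 0 < alpha -> 0 < a -> 0 < r ->
  (1 + alpha) * a `^ (- alpha) - alpha * a `^ (- alpha - 1) * r <= r `^ (- alpha).
Proof.
move=> al0 a0 r0.
have ra : 0 < r / a by rewrite divr_gt0.
have -> : r `^ (- alpha) = a `^ (- alpha) * (r / a) `^ (- alpha).
  by rewrite -powRM ?ltW// mulrC divfK// gt_eqF.
have -> : a `^ (- alpha - 1) = a `^ (- alpha) * a^-1.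
  rewrite powRD; last by apply/implyP => _; rewrite gt_eqF.
  by rewrite powR_inv1// ltW.
have ap : 0 < a `^ (- alpha) by exact: powR_gt0.
have -> : (1 + alpha) * a `^ (- alpha) - alpha * (a `^ (- alpha) * a^-1) * r =
  a `^ (- alpha) * (1 - alpha * (r / a - 1)) by ring.
rewrite ler_pM2l// /powR gt_eqF//.
apply: (@le_trans _ _ (1 + - alpha * ln (r / a))); last exact: expR_ge1Dx.
rewrite mulNr lerD2l lerN2 ler_pM2l//.
have := @le_ln1Dx R (r / a - 1).
rewrite addrCA subrr addr0; apply.
by rewrite ltrBrDl subrr.
Qed.

(** Concavity of the sine on [[0, pi]], in tangent-line form, so that it can be
    integrated against a density of known mean. *)
Lemma sin_tangent (b be : R) : 0 <= b <= pi -> 0 <= be <= pi ->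
  sin be <= sin b + cos b * (be - b).
Proof.
move=> b0 be0.
have cos_mono u w : 0 <= u -> u <= w -> w <= pi -> cos w <= cos u :> R.
  move=> u0 uw wp; rewrite le_eqVlt in uw; case/predU1P: uw => [->//|uw].
  by apply: ltW; rewrite ltr_cos// in_itv/=; apply/andP; split; lra.
have [bb|bb|->] := ltgtP be b; last by rewrite subrr mulr0 addr0.
  have [c /andP[c1 c2] E] := mean_value (fun x : R => is_derive_sin x) bb.
  have := cos_mono c b; nra.
have [c /andP[c1 c2] E] := mean_value (fun x : R => is_derive_sin x) bb.
have := cos_mono b c; nra.
Qed.

Lemma cos_ge_1B (x : R) : 1 - `|x| <= cos x.
Proof.
have [x0|x0|->] := ltgtP x 0; last by rewrite cos0 normr0 subr0.
  have [c _ E] := mean_value (fun x : R => is_derive_cos x) x0.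
  rewrite cos0 in E; rewrite ltr0_norm//.
  have := sin_le1 c; have := sin_geN1 c; nra.
have [c _ E] := mean_value (fun x : R => is_derive_cos x) x0.
rewrite cos0 in E; rewrite gtr0_norm//.
have := sin_le1 c; have := sin_geN1 c; nra.
Qed.

Lemma sin_pi_ge0 (v : R) : v \in `[0, 1[ -> 0 <= sin (pi * v).
Proof.
rewrite in_itv/= => /andP[v0 v1].
apply: sin_ge0_pi; apply/andP; split; first exact: mulr_ge0 (pi_ge0 _) v0.
by rewrite ger_pMr ?pi_gt0// ltW.
Qed.

Lemma measurable_sin_powR alpha :
  measurable_fun setT (fun v : R => sin (pi * v) `^ (- alpha)).
Proof.
apply: (measurableT_comp (measurable_powR _)).
apply: continuous_measurable_fun => x.
apply: (@continuous_comp _ _ _ (fun v => pi * v) sin); last exact: continuous_sin.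
by apply: cvgM; [exact: cvg_cst|exact: cvg_id].
Qed.

End calculus.

(** * Integrals of periodic functions *)

Section periodic_integral.
Context {R : realType}.
Local Notation leb := (@lebesgue_measure R).

Lemma lebesgue_measure_shift (v : R) (A : set R) : measurable A ->
  leb ((fun x => x + v) @^-1` A) = leb A.
Proof.
move=> mA.
have mv : measurable_fun (setT : set (measurableTypeR R)) ((fun x => x + v) : _ -> measurableTypeR R).
  by apply: continuous_measurable_fun => x; apply: cvgD; [exact: cvg_id|exact: cvg_cst].
pose mu := measure_function.pushforward leb ((fun x => x + v) : measurableTypeR R -> measurableTypeR R).
apply/esym; apply: (@lebesgue_measure_unique R mu) => // _ [[a b] _ <-] /=.
rewrite /mu /measure_function.pushforward.
rewrite (_ : _ @^-1` _ = `]a - v, b - v]%classic); last first.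
  by apply/seteqP; split => x; rewrite /= !in_itv/= ltrBlDr lerBrDr.
by rewrite !lebesgue_measure_itv/= !lte_fin ltrD2r; case: ifP => // _; congr (_%:E); lra.
Qed.

Lemma ge0_integral_shift (v : R) (D : set R) (f : R -> \bar R) :
  measurable D -> measurable_fun D f -> (forall x, D x -> 0 <= f x)%E ->
  (\int[leb]_(x in D) f x = \int[leb]_(x in (fun x => x + v)%R @^-1` D) f (x + v)%R)%E.
Proof.
move=> mD mf f0.
have mv : measurable_fun (setT : set (measurableTypeR R)) ((fun x => x + v) : _ -> measurableTypeR R).
  by apply: continuous_measurable_fun => x; apply: cvgD; [exact: cvg_id|exact: cvg_cst].
rewrite -(ge0_integral_pushforward mv leb mD mf); last by move=> x /[!inE]; exact: f0.
by apply: eq_measure_integral => A mA _; symmetry; exact: lebesgue_measure_shift.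
Qed.

Lemma ge0_integral_period (s : R) (f : R -> \bar R) : 0 <= s < 1 ->
  measurable_fun setT f -> (forall x, 0 <= f x)%E ->
  (forall x, f (x + 1)%R = f x) ->
  (\int[leb]_(t in `[0%R, 1%R[) f t = \int[leb]_(v in `[0%R, 1%R[) f (v + s)%R)%E.
Proof.
move=> /andP[s0 s1] mf f0 f1.
have mfD D : measurable D -> measurable_fun D f.
  by move=> mD; exact: measurable_funS mf.
have itv_split (a b c : R) : a <= b <= c ->
    (\int[leb]_(t in `[a, c[) f t =
     \int[leb]_(t in `[a, b[) f t + \int[leb]_(t in `[b, c[) f t)%E.
  move=> /andP[ab bc].
  rewrite -ge0_integral_setU//; [|by apply: mfD; exact: measurableU|].
    congr (integral _ _ _); apply/seteqP; split => x; rewrite /= !in_itv/=.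
      move=> /andP[ax xc]; have [xb|xb] := ltP x b; [left|right];
      by rewrite ?ax ?xc.
    by case=> /andP[h1 h2]; apply/andP; split => //;
      [exact: lt_le_trans bc|exact: le_trans h1].
  apply/disj_setPS => x []; rewrite /= !in_itv/= => /andP[_ xb] /andP[bx _].
  by move: bx; rewrite leNgt xb.
have -> : (\int[leb]_(v in `[0%R, 1%R[) f (v + s)%R =
           \int[leb]_(t in `[s, (1 + s)%R[) f t)%E.
  rewrite (ge0_integral_shift s (D := `[s, (1 + s)%R[%classic))//; last exact: mfD.
  congr (integral _ _ _); apply/seteqP; split => x; rewrite /= !in_itv/=.
    by rewrite lerDr ltrD2r.
  by rewrite lerDr ltrD2r.
rewrite (itv_split _ s 1) ?s0 ?ltW// (itv_split _ 1 (1 + s)) ?lerDl ?s0 ?ltW//.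
rewrite addeC; congr (_ + _)%E.
rewrite (ge0_integral_shift 1 (D := `[1, (1 + s)%R[%classic))//; last exact: mfD.
rewrite (_ : _ @^-1` _ = `[0, s[%classic).
  by apply: eq_integral => x _; rewrite f1.
apply/seteqP; split => x; rewrite /= !in_itv/=.
  by rewrite lerDr (addrC x) ltrD2l.
by rewrite lerDr (addrC x) ltrD2l.
Qed.

Lemma fubini_tonelli_square (g : R * R -> \bar R) :
  measurable_fun setT g -> (forall x, 0 <= g x)%E ->
  (\int[leb]_(s in `[0%R, 1%R[) \int[leb]_(t in `[0%R, 1%R[) g (s, t) =
   \int[leb]_(t in `[0%R, 1%R[) \int[leb]_(s in `[0%R, 1%R[) g (s, t))%E.
Proof.
move=> mg g0.
pose I : set R := `[0, 1[%classic.
have mI : measurable I by exact: measurable_itv.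
pose h := g \_ (I `*` I).
have mh : measurable_fun setT h.
  apply/(measurable_restrictT _ _).1; first exact: measurableX.
  exact: measurable_funS mg.
have h0 x : (0 <= h x)%E by rewrite /h patchE; case: ifP.
have hE s t : (h (s, t) = if (s \in I) && (t \in I) then g (s, t) else 0)%E.
  rewrite /h patchE; congr (if _ then _ else _).
  by apply/idP/andP; rewrite !inE.
have := @fubini_tonelli _ _ (measurableTypeR R) (measurableTypeR R) R leb leb h mh h0.
have inner1 s : (\int[leb]_t h (s, t) = ((fun s => \int[leb]_(t in I) g (s, t)) \_ I) s)%E.
  rewrite patchE; case: ifPn => sI.
    rewrite [RHS]integral_mkcond; apply: eq_integral => t _.
    by rewrite hE sI/= patchE.
  by rewrite integral0_eq// => t _; rewrite hE (negbTE sI).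
have inner2 t : (\int[leb]_s h (s, t) = ((fun t => \int[leb]_(s in I) g (s, t)) \_ I) t)%E.
  rewrite patchE; case: ifPn => tI.
    rewrite [RHS]integral_mkcond; apply: eq_integral => s _.
    by rewrite hE tI/= patchE andbT.
  by rewrite integral0_eq// => s _; rewrite hE (negbTE tI) andbF.
move=> swap; rewrite [LHS]integral_mkcond [RHS]integral_mkcond.
transitivity (\int[leb]_s \int[leb]_t h (s, t))%E.
  by apply: eq_integral => s _; rewrite inner1.
by rewrite swap; apply: eq_integral => t _; rewrite inner2.
Qed.

Lemma measurable_fun_integral_period (g : R * R -> \bar R) :
  measurable_fun setT g -> (forall x, 0 <= g x)%E ->
  measurable_fun setT (fun s => \int[leb]_(t in `[0%R, 1%R[) g (s, t))%E.
Proof.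
move=> mg g0.
pose I : set R := `[0, 1[%classic.
have mI : measurable I by exact: measurable_itv.
pose h := g \_ (setT `*` I).
have mh : measurable_fun setT h.
  apply/(measurable_restrictT _ _).1; first exact: measurableX.
  exact: measurable_funS mg.
have h0 x : (0 <= h x)%E by rewrite /h patchE; case: ifP.
have -> : (fun s => \int[leb]_(t in I) g (s, t))%E = (fun s => \int[leb]_t h (s, t))%E.
  apply/funext => s; rewrite [LHS]integral_mkcond; apply: eq_integral => t _.
  rewrite /h !patchE; congr (if _ then _ else _).
  by apply/idP/idP; rewrite !inE/=; [|case].
exact: (@measurable_fun_fubini_tonelli_F _ _ (measurableTypeR R) (measurableTypeR R) R leb h mh h0).
Qed.

Lemma measurable_fun_shear (g : R * R -> \bar R) : measurable_fun setT g ->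
  measurable_fun setT (fun sv : R * R => g (sv.1, sv.2 + sv.1)%R).
Proof.
move=> mg.
apply: (measurableT_comp mg).
apply: measurable_fun_pair; first exact: measurable_fst.
by apply: measurable_funD; [exact: measurable_snd|exact: measurable_fst].
Qed.

(** Integrating over the torus along its diagonals. *)
Lemma integral_torus_shear (g : R * R -> \bar R) :
  measurable_fun setT g -> (forall x, 0 <= g x)%E ->
  (forall s t, g (s, t + 1)%R = g (s, t)) ->
  (\int[leb]_(s in `[0%R, 1%R[) \int[leb]_(t in `[0%R, 1%R[) g (s, t) =
   \int[leb]_(v in `[0%R, 1%R[) \int[leb]_(s in `[0%R, 1%R[) g (s, v + s)%R)%E.
Proof.
move=> mg g0 g1.
transitivity (\int[leb]_(s in `[0%R, 1%R[) \int[leb]_(v in `[0%R, 1%R[) g (s, v + s)%R)%E.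
  apply: eq_integral => s; rewrite inE/= in_itv/= => s01.
  apply: (ge0_integral_period s01) => //.
  apply: (measurableT_comp mg); apply: measurable_fun_pair => //.
exact: (fubini_tonelli_square (measurable_fun_shear mg)).
Qed.

End periodic_integral.

(** * Hausdorff measure on a curve *)

Section hausdorff.
Context {R : realType}.
Local Notation plane := (R * R)%type.
Implicit Types (A U : set plane).

Lemma enorm_ge0 (v : plane) : 0 <= enorm v.
Proof. exact: sqrtr_ge0. Qed.

Lemma enorm_sym (u v : plane) : enorm (u - v) = enorm (v - u).
Proof. by rewrite /enorm /dot/=; congr Num.sqrt; ring. Qed.

Lemma enorm_eq0 (v : plane) : enorm v = 0 -> v = 0.
Proof.
move/eqP; rewrite /enorm sqrtr_eq0 /dot -!expr2 => h.
have h1 := sqr_ge0 v.1; have h2 := sqr_ge0 v.2.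
have /eqP : v.1 ^+ 2 = 0 by apply/eqP; rewrite eq_le; apply/andP; split => //; lra.
have /eqP : v.2 ^+ 2 = 0 by apply/eqP; rewrite eq_le; apply/andP; split => //; lra.
by rewrite !sqrf_eq0; case: v {h h1 h2} => a b /= /eqP -> /eqP ->.
Qed.

Lemma continuous_fst_comp (T : topologicalType) (f : T -> plane) :
  continuous f -> continuous (fun x => (f x).1).
Proof. by move=> fc x; apply: (cvg_comp _ _ (fc x)); exact: cvg_fst. Qed.

Lemma continuous_snd_comp (T : topologicalType) (f : T -> plane) :
  continuous f -> continuous (fun x => (f x).2).
Proof. by move=> fc x; apply: (cvg_comp _ _ (fc x)); exact: cvg_snd. Qed.

Lemma continuous_enorm (T : topologicalType) (f : T -> plane) :
  continuous f -> continuous (fun x => enorm (f x)).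
Proof.
move=> fc x; rewrite /enorm /dot.
apply: (@cvg_comp _ _ _ (fun x => (f x).1 * (f x).1 + (f x).2 * (f x).2) Num.sqrt);
  last exact: sqrt_continuous.
by apply: cvgD; apply: cvgM; (exact: continuous_fst_comp || exact: continuous_snd_comp).
Qed.

Lemma proj_le_enorm (v : plane) (c s : R) : c ^+ 2 + s ^+ 2 = 1 ->
  `|c * v.1 + s * v.2| <= enorm v.
Proof.
move=> cs; rewrite -sqrtr_sqr /enorm ler_sqrt; last first.
  by rewrite /dot addr_ge0// -expr2 sqr_ge0.
rewrite -[leRHS]mul1r -cs /dot -subr_ge0.
rewrite (_ : _ - _ = (c * v.2 - s * v.1) ^+ 2) ?sqr_ge0//; ring.
Qed.

Lemma diam_le A (w : R) : 0 <= w ->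
  (forall p q, A p -> A q -> enorm (p - q) <= w) -> (diam A <= w%:E)%E.
Proof.
move=> w0 Aw; rewrite /diam ge_max lee_fin w0/=.
by apply: ge_ereal_sup => _ [[p q]/= [Ap Aq]] <-; rewrite lee_fin; exact: Aw.
Qed.

Lemma le_diam A p q : A p -> A q -> ((enorm (p - q))%:E <= diam A)%E.
Proof.
move=> Ap Aq; rewrite /diam le_max; apply/orP; right.
by apply: ereal_sup_ubound; exists (p, q).
Qed.

Lemma diam_ge0 A : (0 <= diam A)%E.
Proof. by rewrite /diam le_max lexx. Qed.

Lemma diam0 : diam (set0 : set plane) = 0%E.
Proof.
by apply/eqP; rewrite eq_le diam_ge0 andbT; apply: diam_le.
Qed.

(** Giving infinite weight to the sets of diameter larger than [delta] turns the
    size-[delta] premeasure into the outer measure generated by a set function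
    on the sigma-algebra of all subsets; subadditivity then comes for free. *)
Let all_sets := g_sigma_algebraType [set: set plane].
Let small_diam (delta : R) (U : set all_sets) : \bar R :=
  if (diam (U : set plane) <= delta%:E)%E then diam (U : set plane) else +oo%E.

Lemma hausdorff1_delta_sigma_subadditive (delta : R) (A : (set plane)^nat) :
  0 < delta ->
  (hausdorff1_delta delta (\bigcup_n A n) <=
   \sum_(0 <= n <oo) hausdorff1_delta delta (A n))%E.
Proof.
move=> d0.
have w0 (U : set all_sets) : (0 <= small_diam delta U)%E.
  by rewrite /small_diam; case: ifPn => // _; exact: diam_ge0.
have wset0 : small_diam delta set0 = 0%E.
  by rewrite /small_diam diam0 lee_fin ltW.
have HE B : hausdorff1_delta delta B = mu_ext (small_diam delta) B.
  apply/eqP; rewrite eq_le; apply/andP; split.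
    apply: le_ereal_inf_tmp => _ [V [mV BV]] <-.
    have [small|] := pselect (forall n, (diam (V n : set plane) <= delta%:E)%E).
      rewrite (_ : (\sum_(k <oo) _)%E = (\sum_(k <oo) diam (V k : set plane))%E).
        by apply: ereal_inf_lbound; exists V.
      by apply: eq_eseriesr => n _; rewrite /small_diam small.
    move/existsNP => [n /negP Vn].
    rewrite (@eseries_pinfty _ _ xpredT n) ?leey// ?/small_diam ?(negbTE Vn)//.
    move=> k _; rewrite -ltNye (lt_le_trans _ (w0 _))//.
  apply: le_ereal_inf_tmp => _ [V [BV small]] <-.
  apply: ereal_inf_lbound; exists V.
    by split => // n; exact: sub_sigma_algebra.
  by apply: eq_eseriesr => n _; rewrite /small_diam small.
rewrite HE (eq_eseriesr (fun n _ => HE (A n))).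
exact: (mu_ext_sigma_subadditive w0).
Qed.

Section param.
Variables (P : R -> plane) (L : R).
Hypothesis L0 : 0 < L.
Hypothesis P_lip : forall s t, enorm (P t - P s) <= L * `|t - s|.

Lemma hausdorff1_delta_segment (delta a b : R) : 0 < delta -> a <= b ->
  (hausdorff1_delta delta (P @` `]a, b]) <= (L * (b - a))%:E)%E.
Proof.
move=> d0 ab.
pose N := (Num.trunc (L * (b - a) / delta)).+1.
have N0 : 0 < N%:R :> R by rewrite ltr0n.
have ba0 : 0 <= b - a by rewrite subr_ge0.
pose h := (b - a) / N%:R.
have h0 : 0 <= h by rewrite /h divr_ge0// ltW.
have hN : N%:R * h = b - a by rewrite /h mulrC divfK// gt_eqF.
have Lh : L * h <= delta.
  rewrite -(ler_pM2r N0) -mulrA [h * _]mulrC hN.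
  rewrite -ler_pdivrMl// mulrC ltW// /N.
  by rewrite truncnS_gt.
pose U n := if (n < N)%N then P @` `]a + n%:R * h, a + n.+1%:R * h] else set0.
have dU n : (diam (U n) <= (L * h)%:E)%E.
  rewrite /U; case: ifPn => _; last first.
    by rewrite diam0 lee_fin mulr_ge0// ltW.
  apply: diam_le; first by rewrite mulr_ge0// ltW.
  move=> _ _ [s /= si <-] [t /= ti <-].
  rewrite (le_trans (P_lip _ _))// ler_wpM2l ?(ltW L0)//.
  move: si ti; rewrite !in_itv/= -natr1 mulrDl mul1r => /andP[s1 s2] /andP[t1 t2].
  rewrite ler_norml; apply/andP; split; lra.
apply: (@le_trans _ _ (\sum_(0 <= n <oo) diam (U n))%E).
  apply: ereal_inf_lbound; exists U => //; split; last first.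
    by move=> n; rewrite (le_trans (dU n))// lee_fin.
  move=> _ [s /= /[!in_itv]/= /andP[sa sb] <-].
  have h1 : 0 < h.
    by rewrite /h divr_gt0// subr_gt0 (lt_le_trans sa).
  pose c : int := Num.ceil ((s - a) / h).
  have c1 : 0 < c by rewrite ceil_gt0 divr_gt0// subr_gt0.
  have [m cm] : exists m : nat, c = m.+1%:Z.
    by case: c c1 => [[//|m] _|//]; exists m.
  exists m => //; rewrite /U.
  have lo : a + m%:R * h < s.
    have := ceilB1_lt ((s - a) / h); rewrite -/c cm.
    rewrite -addn1 PoszD addrK ltr_pdivlMr// => mh.
    by rewrite -ltrBrDl.
  have hi : s <= a + m.+1%:R * h.
    have := ceil_ge ((s - a) / h); rewrite -/c cm ler_pdivrMr//.
    by rewrite -lerBlDl.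
  have -> : (m < N)%N.
    rewrite -(ltr_nat R) -(ltr_pM2r h1) hN.
    by rewrite -(ltrD2l a) (lt_le_trans lo)// addrC subrK.
  by exists s => //=; rewrite in_itv/= lo hi.
rewrite (nneseries_split 0 N)//= ?add0n; last by move=> *; exact: diam_ge0.
rewrite eseries0 ?adde0; last first.
  by move=> i Ni _; rewrite /U ltnNge Ni/= diam0.
apply: (@le_trans _ _ (\sum_(0 <= k < N) (L * h)%:E)%E).
  exact: lee_sum.
rewrite sumEFin lee_fin sumr_const_nat subn0 -mulr_natl mulrCA hN.
by rewrite mulrC.
Qed.

(** A Lipschitz map does not increase lengths by more than its constant: cut the
    intervals of an almost optimal cover of [E] into short pieces and push them
    forward. *)
Lemma hausdorff1_image_le (E : set R) : measurable E ->
  (hausdorff1 (P @` E) <= L%:E * lebesgue_measure E)%E.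
Proof.
move=> mE; apply: ge_ereal_sup => _ [delta d0 <-].
have [->|Efin] := eqVneq (lebesgue_measure E) +oo%E.
  by rewrite gt0_muley ?leey// lte_fin.
have Ef : lebesgue_measure E \is a fin_num.
  by rewrite ge0_fin_numE// ltey.
apply/lee_addgt0Pr => e e0.
have eL : 0 < e / L by rewrite divr_gt0.
have [_ [A [mA EA] <-]] := lb_ereal_inf_adherent eL Ef.
set S := (X in (X < _)%E) => SE.
apply: (@le_trans _ _ (hausdorff1_delta delta (\bigcup_n P @` (A n)))).
  apply: le_ereal_inf => _ [V [AV dV]] <-; exists V => //; split => //.
  apply: subset_trans AV => _ [s Es <-].
  by have [n _ An] := EA _ Es; exists n => //; exists s.
apply: le_trans; first exact: hausdorff1_delta_sigma_subadditive.
apply: (@le_trans _ _ (L%:E * S)%E); last first.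
  have -> : (L%:E * lebesgue_measure E + e%:E = L%:E * (lebesgue_measure E + (e / L)%:E))%E.
    rewrite ge0_muleDr// ?lee_fin ?ltW// -EFinM mulrCA divff ?mulr1// gt_eqF//.
  by rewrite lee_pmul2l ?lte_fin// ltW.
rewrite /S -nneseriesZl//.
apply: lee_nneseries => n _.
- move=> _; apply: le_ereal_inf_tmp => _ [V _ <-]; apply: nneseries_ge0 => *; exact: diam_ge0.
- have [[a b] _ /= <-] := mA n.
  rewrite wlength_itv/= lte_fin; case: ltP => ab.
    by rewrite -EFinB -EFinM; apply: hausdorff1_delta_segment => //; exact: ltW.
  rewrite mule0 set_itv_ge ?bnd_simp -?leNgt// image_set0.
  apply: (@le_trans _ _ (\sum_(0 <= n <oo) diam (set0 : set plane))%E).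
    apply: ereal_inf_lbound; exists (fun=> set0) => //; split => // _.
    by rewrite diam0 lee_fin ltW.
  by rewrite eseries0// => *; rewrite diam0.
Qed.

End param.
End hausdorff.

Section param_lower.
Context {R : realType}.
Local Notation plane := (R * R)%type.
Local Notation leb := (@lebesgue_measure R).
Variables (P : R -> plane) (L : R).
Hypothesis L0 : 0 < L.
Hypothesis P_lip : forall s t, enorm (P t - P s) <= L * `|t - s|.
Hypothesis P_cont : continuous P.
Hypothesis P_inj : {in `[0, 1[ &, injective P}.
Hypothesis P_loc : forall e : R, 0 < e -> exists2 tau : R, 0 < tau &
  forall s t : R, s \in `[0, 1] -> t \in `[0, 1] -> `|t - s| < tau ->
    (1 - e) * (L * `|t - s|) <= enorm (P t - P s).

(** On a closed sub-arc that does not close up, small chords come from small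
    parameter gaps: otherwise the chord length, which does not vanish on the
    compact set of pairs with a gap, would still be arbitrarily small there. *)
Lemma small_chord_small_gap (c tau : R) : c < 1 -> 0 < tau ->
  exists2 delta : R, 0 < delta & forall s t : R, s \in `[0, c] -> t \in `[0, c] ->
    enorm (P t - P s) <= delta -> `|t - s| < tau.
Proof.
move=> c1 tau0.
pose C := (`[0, c]%classic `*` `[0, c]%classic) `&`
  [set st : R * R | tau <= `|st.2 - st.1|].
pose f (st : R * R) := enorm (P st.2 - P st.1).
have fst_c : continuous (fun st : R * R => st.1) by move=> [a b]; exact: cvg_fst.
have snd_c : continuous (fun st : R * R => st.2) by move=> [a b]; exact: cvg_snd.
have cC : compact C.
  apply: (@subclosed_compact _ _ (`[0, c]%classic `*` `[0, c]%classic)).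
  - apply: closedI.
      apply: compact_closed; first exact: norm_hausdorff.
      by apply: compact_setX; exact: segment_compact.
    apply: (@preimage_closed _ _ (fun st : R * R => `|st.2 - st.1|) [set x | tau <= x]).
      by move=> st _; apply: cvg_norm; apply: cvgB; [exact: snd_c|exact: fst_c].
    exact: closed_ge.
  - by apply: compact_setX; exact: segment_compact.
  - by move=> x [].
have P1c : continuous (fun st : R * R => P st.1).
  by move=> st; apply: continuous_comp; [exact: fst_c|exact: P_cont].
have P2c : continuous (fun st : R * R => P st.2).
  by move=> st; apply: continuous_comp; [exact: snd_c|exact: P_cont].
have fc : continuous f.
  by apply: continuous_enorm => st; exact: (cvgB (P2c st) (P1c st)).
have cfC : closed (f @` C).
  apply: compact_closed; first exact: Rhausdorff.
  by apply: continuous_compact => //; exact: continuous_subspaceT.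
have : (~` (f @` C)) 0.
  move=> [[s t]] [[/= si ti] st] /enorm_eq0 /eqP; rewrite subr_eq0 => /eqP Pts.
  have in01 x : x \in `[0, c] -> x \in `[0, 1[.
    by rewrite !in_itv/= => /andP[-> /le_lt_trans ->].
  have := P_inj (in01 _ ti) (in01 _ si) Pts => ts.
  by move: st; rewrite ts subrr normr0 leNgt tau0.
have oC : open (~` (f @` C)) by rewrite openC.
move=> /oC; rewrite /= => /nbhs_ballP[d /= d0 dC].
exists (d / 2); first by rewrite divr_gt0.
move=> s t si ti std; rewrite ltNge; apply/negP => st.
have : ball 0 d (f (s, t)).
  rewrite /ball/= sub0r normrN ger0_norm ?enorm_ge0//.
  by rewrite (le_lt_trans std)// gtr_pMr// invf_lt1// ltr1n.
by move=> /dC; apply; exists (s, t).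
Qed.

(** The sets of a fine cover of the image pull back to sets of parameters with
    small gaps, where arcs are almost as short as chords; the hulls of these
    pullbacks cover [E], up to the end of the period, which is removed because
    the curve closes up there. *)
Lemma hausdorff1_image_ge (E : set R) : measurable E -> E `<=` `[0, 1[ ->
  (L%:E * leb E <= hausdorff1 (P @` E))%E.
Proof.
move=> mE E01.
have E1 : (leb E <= 1)%E.
  apply: (@le_trans _ _ (leb (`[0, 1[%classic : set R))).
    by apply: le_measure => //; rewrite inE//; exact: measurable_itv.
  by rewrite lebesgue_measure_itv/= lte_fin ltr01 sube0.
have Ef : leb E \is a fin_num.
  by rewrite ge0_fin_numE// (le_lt_trans E1)// ltry.
pose l := fine (leb E).
have lE : leb E = l%:E by rewrite /l fineK.
suff H (e : R) : 0 < e < 1 ->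
    (((1 - e) * (L * (l - e)))%:E <= hausdorff1 (P @` E))%E.
  rewrite lE -EFinM.
  case HE : (hausdorff1 (P @` E)) => [r| |]; [|by rewrite leey|]; last first.
    have e12 : 0 < (2^-1 : R) < 1 by rewrite invr_gt0 ltr0n/= invf_lt1// ltr1n.
    by have := H _ e12; rewrite HE leeNy_eq.
  rewrite lee_fin leNgt; apply/negP => rl.
  have l0 : 0 <= l by rewrite /l fine_ge0.
  have l1 : l <= 1 by rewrite -lee_fin -lE.
  have D0 : 0 < 4 * L by rewrite mulr_gt0.
  pose e := Num.min (2^-1) ((L * l - r) / (4 * L)).
  have e0 : 0 < e by rewrite lt_min invr_gt0 ltr0n/= divr_gt0// subr_gt0.
  have e12 : e <= 2^-1 by rewrite ge_min lexx.
  have eL : e * (4 * L) <= L * l - r by rewrite -ler_pdivlMr// ge_min lexx orbT.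
  have : 0 < e < 1 by rewrite e0/= (le_lt_trans e12)// invf_lt1// ltr1n.
  move=> /H; rewrite HE lee_fin leNgt => /negP; apply.
  nra.
move=> /andP[e0 e1].
have e10 : 0 < 1 - e by rewrite subr_gt0.
have w0 : 0 < (1 - e) * L by rewrite mulr_gt0.
have [tau tau0 Ptau] := P_loc e0.
have ce : 1 - e < 1 by rewrite gtrBl.
have [delta delta0 Pdelta] := small_chord_small_gap ce tau0.
apply: (@le_trans _ _ (hausdorff1_delta delta (P @` E))); last first.
  by apply: ereal_sup_ubound; exists delta.
apply: le_ereal_inf_tmp => _ [U [EU dU]] <-.
pose Ec := E `&` `[0, 1 - e].
have mEc : measurable Ec by apply: measurableI.
have lEc : ((l - e)%:E <= leb Ec)%E.
  have E2 : E `<=` Ec `|` `]1 - e, 1[%classic.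
    move=> x Ex; have := E01 _ Ex; rewrite /= in_itv/= => /andP[x0 x1].
    have [xe|xe] := leP x (1 - e).
      by left; split => //=; rewrite in_itv/= x0.
    by right; rewrite /= in_itv/= xe.
  have : (leb E <= leb Ec + leb (`](1 - e)%R, 1%R[%classic : set R))%E.
    apply: (@le_trans _ _ (leb (Ec `|` `](1 - e)%R, 1%R[%classic))).
      by apply: le_measure => //; rewrite inE//; exact: measurableU.
    exact: measureU2.
  rewrite lebesgue_measure_itv/= lte_fin ce lE -EFinB opprB addrCA subrr addr0.
  by move=> h; rewrite EFinB leeBlDr.
pose S n := Ec `&` P @^-1` (U n).
pose w n := fine (diam (U n)) / ((1 - e) * L).
have dfin n : diam (U n) \is a fin_num.
  by rewrite ge0_fin_numE ?diam_ge0// (le_lt_trans (dU n))// ltry.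
have w_ge0 n : 0 <= w n.
  by rewrite /w divr_ge0// ?fine_ge0 ?diam_ge0// ltW.
have Sw n s t : S n s -> S n t -> `|t - s| <= w n.
  move=> [[Es sc] Us] [[Et tc] Ut].
  have dst : enorm (P t - P s) <= fine (diam (U n)).
    by rewrite -lee_fin fineK//; apply: le_diam.
  rewrite /w ler_pdivlMr// mulrC -mulrA (le_trans _ dst)//.
  have i01 x : `[0, 1 - e]%classic x -> x \in `[0, 1].
    by rewrite /= !in_itv/= => /andP[-> xe]; rewrite (le_trans xe)// gerBl ltW.
  apply: Ptau; [exact: i01|exact: i01|].
  apply: (Pdelta s t) => //.
  by rewrite (le_trans dst)// -lee_fin fineK.
pose I n : set R := if `[< S n !=set0 >] then
  [set` `[inf (S n), inf (S n) + w n]] else set0.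
have mI n : measurable (I n) by rewrite /I; case: ifP => _; [exact: measurable_itv|exact: measurable0].
have lI n : (leb (I n) <= (w n)%:E)%E.
  rewrite /I; case: ifP => _; last by rewrite measure0 lee_fin.
  rewrite lebesgue_measure_itv/= lte_fin; case: ifPn; last by rewrite lee_fin.
  by rewrite -EFinB lee_fin addrAC subrr add0r.
have EI : Ec `<=` \bigcup_n I n.
  move=> t Et; have [n _ Un] := EU (P t) (imageP P Et.1).
  exists n => //; rewrite /I ifT; last by apply/asboolP; exists t.
  have St : S n t by [].
  have lb : has_lbound (S n) by exists 0 => s [[_ /= +] _]; rewrite in_itv/= => /andP[].
  rewrite /= in_itv/= inf_lbound//= -lerBlDr.
  apply: lb_le_inf; first by exists t.
  move=> s Ss.
  by have := Sw _ _ _ Ss St; rewrite ler_norml => /andP[_]; lra.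
have : (leb Ec <= \sum_(0 <= n <oo) (w n)%:E)%E.
  apply: (@le_trans _ _ (\sum_(0 <= n <oo) leb (I n))%E); last first.
    by apply: lee_nneseries => // n _; exact: measure_ge0.
  exact: measure_sigma_subadditive.
have -> : (\sum_(0 <= n <oo) (w n)%:E =
    (((1 - e) * L)^-1)%:E * \sum_(0 <= n <oo) diam (U n))%E.
  rewrite -nneseriesZl; [|by move=> *; exact: diam_ge0].
  by apply: eq_eseriesr => n _; rewrite /w EFinM fineK// muleC.
move=> /(le_trans lEc); rewrite -lee_pdivrMl ?invr_gt0//.
by rewrite -EFinM invrK mulrA.
Qed.

End param_lower.

Section param_integral.
Import HBNNSimple.
Context {R : realType}.
Local Notation plane := (R * R)%type.
Local Notation leb := (@lebesgue_measure R).
Variables (P : R -> plane) (L : R).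
Hypothesis P_cont : continuous P.

(** The image is compact. The Borel sets of the plane are given here as the
    product sigma-algebra, so that a closed set is exhibited as a countable
    intersection of countable unions of boxes centered at rational parameters. *)
Lemma measurable_image_segment (c : R) : 0 <= c -> measurable (P @` `[0, c]).
Proof.
move=> c0.
pose clamp (x : R) := Num.min (Num.max x 0) c.
have clampc : continuous clamp.
  move=> x; refine (@continuous_min R R (fun x => Num.max x 0) (cst c) x _ _).
    by refine (@continuous_max R R id (cst 0) x _ _); [exact: cvg_id|exact: cvg_cst].
  exact: cvg_cst.
have clamp_in x : 0 <= clamp x <= c.
  by rewrite /clamp le_min c0 le_max lexx orbT ge_min lexx orbT.
have clamp_id x : 0 <= x <= c -> clamp x = x.
  by move=> /andP[x0 xc]; rewrite /clamp (max_idPl x0) (min_idPl xc).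
pose f x := P (clamp x).
have fc : continuous f by move=> x; apply: continuous_comp; [exact: clampc|exact: P_cont].
pose h n : R := n.+1%:R^-1.
pose box n (r : rat) : set plane := `](f (ratr r)).1 - h n, (f (ratr r)).1 + h n[%classic `*`
   `](f (ratr r)).2 - h n, (f (ratr r)).2 + h n[%classic.
rewrite (_ : P @` _ = \bigcap_n \bigcup_(r in [set: rat]) box n r); last first.
  apply/seteqP; split => [_ [s /= s0c <-] n _|q qbox].
    move: s0c; rewrite in_itv/= => s0c.
    have hn0 : 0 < h n by rewrite invr_gt0 ltr0n.
    have : nbhs s (f @^-1` (ball (f s) (h n))).
      by apply: (fc s); exact: nbhsx_ballx.
    move=> /nbhs_ballP[d /= d0 dP].
    have [] := @dense_rat R (ball s d) _ _.
    - by exists s; exact: ballxx.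
    - exact: ball_open.
    move=> x [dx [r _ rE]]; exists r => //.
    have sr := dP _ dx; rewrite -rE in sr.
    move: sr; rewrite /= {1}/f clamp_id//.
    by move=> [/= h1 h2]; split; rewrite /= in_itv/= -ltr_distlC distrC.
  have cl : closed (P @` `[0, c]).
    apply: compact_closed; first exact: norm_hausdorff.
    apply: continuous_compact; last exact: segment_compact.
    exact: continuous_subspaceT.
  apply: cl => B /nbhs_ballP[d /= d0 dB].
  have [n hnd] : exists n, h n < d.
    exists (Num.trunc d^-1); rewrite /h invf_plt ?posrE ?ltr0n//.
    exact: truncnS_gt.
  have [r _ [/= b1 b2]] := qbox n I.
  exists (f (ratr r)); split.
    by exists (clamp (ratr r)) => //=; rewrite in_itv/= clamp_in.
  apply: dB; split; rewrite /= /ball/=.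
    by move: b1; rewrite in_itv/= -ltr_distlC distrC => /lt_trans; exact.
  by move: b2; rewrite in_itv/= -ltr_distlC distrC => /lt_trans; exact.
apply: bigcapT_measurable => n; apply: bigcupT_measurable_rat => r.
by apply: measurableX; exact: measurable_itv.
Qed.

Hypothesis L0 : 0 < L.
Hypothesis P_lip : forall s t, enorm (P t - P s) <= L * `|t - s|.
Hypothesis P_inj : {in `[0, 1[ &, injective P}.
Hypothesis P_loc : forall e : R, 0 < e -> exists2 tau : R, 0 < tau &
  forall s t : R, s \in `[0, 1] -> t \in `[0, 1] -> `|t - s| < tau ->
    (1 - e) * (L * `|t - s|) <= enorm (P t - P s).
Hypothesis P_closed : P 1 = P 0.

Let G : set plane := P @` `[0, 1[.

Lemma measurable_image_prefix (x : R) :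
  measurable (P @` (`[0, 1[ `&` `]-oo, x])).
Proof.
have [x0|x0] := ltP x 0.
  rewrite (_ : _ `&` _ = set0) ?image_set0; first exact: measurable0.
  rewrite -subset0 => y []; rewrite /= !in_itv/= => /andP[y0 _] yx; lra.
have [x1|x1] := ltP x 1.
  rewrite (_ : _ `&` _ = `[0, x]%classic); first exact: measurable_image_segment.
  apply/seteqP; split => [y []|y]; rewrite /= !in_itv/=.
    by move=> /andP[-> _] ->.
  by move=> /andP[-> yx]; rewrite yx (le_lt_trans yx x1).
rewrite (_ : P @` _ = P @` `[0, 1]); first by apply: measurable_image_segment.
apply/seteqP; split => [_ [y [+ _] <-]|_ [y + <-]]; rewrite /= !in_itv/=.
  by move=> /andP[y0 y1]; exists y => //=; rewrite in_itv/= y0 ltW.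
move=> /andP[y0]; rewrite le_eqVlt => /predU1P[->|y1].
  exists 0; last by rewrite P_closed.
  by split; rewrite /= in_itv/= ?lexx ?ltr01// (le_trans ler01).
by exists y => //; split; rewrite /= in_itv/= ?y0// ltW// (lt_le_trans y1).
Qed.

Lemma measurable_curve : measurable G.
Proof.
rewrite /G (_ : `[0, 1[%classic = `[0, 1[ `&` `]-oo, 1]); first exact: measurable_image_prefix.
apply/esym/setIidl => y; rewrite /= !in_itv/=.
by move=> /andP[_ /ltW].
Qed.

(** The parameter of a point of the curve: being a measurable inverse of the
    parametrization, it turns measurability in the parameter into measurability
    on the curve. *)
Let param (y : plane) : R := xget 0 [set x | (x \in `[0, 1[) /\ P x = y].

Let paramK (x : R) : x \in `[0, 1[ -> param (P x) = x.
Proof.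
by move=> x01; rewrite /param; case: xgetP => [y _ [y01 /P_inj->//]|/(_ x)[]].
Qed.

Let measurable_param : measurable_fun G param.
Proof.
move=> mG; apply: (measurability _ (RGenOInfty.measurableE R)) => //.
move=> _ [_ [x ->] <-].
rewrite (_ : _ `&` _ = G `\` (P @` (`[0, 1[ `&` `]-oo, x]))).
  by apply: measurableD => //; exact: measurable_image_prefix.
apply/seteqP; split => [_ [[s s01 <-]]|_ [[s s01 <-]] sx].
  rewrite /= in_itv/= andbT paramK// => xs; split; first by exists s.
  move=> [t [t01 /=]]; rewrite in_itv/= => tx /P_inj ts.
  by move: xs; rewrite -ts// ltNge tx.
split; first by exists s.
rewrite /= in_itv/= andbT paramK// ltNge; apply/negP => xs.
by apply: sx; exists s.
Qed.

Lemma measurable_fun_curve (f : plane -> \bar R) :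
  measurable_fun (`[0, 1[%classic : set R) (f \o P) -> measurable_fun G f.
Proof.
move=> mf mG Y mY.
have := measurable_param mG (mf (measurable_itv _) _ mY).
congr (measurable _); apply/seteqP; split => [_ [[s s01 <-]] [_]|_ [[s s01 <-]]].
  by rewrite /= paramK// => Ys; split => //; exists s.
by move=> Ys; split; [exists s|split; rewrite /= paramK].
Qed.

Lemma hausdorff1_on_curve (B : set plane) : measurable B -> B `<=` G ->
  hausdorff1 B = (L%:E * leb (`[0%R, 1%R[ `&` P @^-1` B))%E.
Proof.
move=> mB BG; set E := _ `&` _.
have mP : measurable_fun setT P.
  apply/measurable_fun_pairP; split; apply: continuous_measurable_fun.
    exact: continuous_fst_comp.
  exact: continuous_snd_comp.
have mE : measurable E.
  apply: measurableI; first exact: measurable_itv.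
  by rewrite -[X in measurable X]setTI; exact: mP.
have -> : B = P @` E.
  apply/seteqP; split => [y By|_ [s [_ Bs] <-]//].
  by have [s s01 sy] := BG _ By; exists s => //; split => //=; rewrite sy.
apply/eqP; rewrite eq_le; apply/andP; split; first exact: hausdorff1_image_le.
by apply: hausdorff1_image_ge => // x [].
Qed.

(** The integral is a supremum over simple functions below the integrand; these
    vanish off the curve, so that only the values on Borel subsets of the curve
    matter, where [hausdorff1] is an image of Lebesgue measure. *)
Lemma integral_hausdorff1_curve (f : plane -> \bar R) :
  measurable_fun (`[0, 1[%classic : set R) (f \o P) ->
  (forall y, G y -> 0 <= f y)%E ->
  (\int[hausdorff1]_(y in G) f y = L%:E * \int[leb]_(x in `[0%R, 1%R[) f (P x))%E.
Proof.
move=> mf f0.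
(* the parametrization, redirected off the curve outside one period, so that the
   preimage of the curve is exactly one period *)
pose o : plane := ((P 0).1 + L + 1, 0).
have Go : ~ G o.
  move=> [x /= /[!in_itv]/= /andP[x0 x1] Px].
  have := P_lip 0 x; rewrite Px subr0 ger0_norm// => h.
  have : (o - P 0).1 <= enorm (o - P 0).
    rewrite /enorm /dot (le_trans (ler_norm _))// -sqrtr_sqr ler_sqrt.
      by rewrite -!expr2 lerDl sqr_ge0.
    by rewrite -!expr2 addr_ge0// sqr_ge0.
  rewrite /o/= => h'; have : L * x <= L by rewrite ger_pMr// ltW.
  lra.
pose phi (x : measurableTypeR R) : plane := if x \in `[0, 1[ then P x else o.
have phiG : phi @^-1` G = `[0, 1[%classic.
  apply/seteqP; split => x; rewrite /phi /=.
    by case: ifPn.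
  by move=> x01; rewrite x01; exists x.
have mP : measurable_fun setT P.
  apply/measurable_fun_pairP; split; apply: continuous_measurable_fun.
    exact: continuous_fst_comp.
  exact: continuous_snd_comp.
have mphi : measurable_fun setT phi.
  apply: measurable_fun_ifT => //.
  apply: (measurable_fun_bool true); rewrite setTI.
  rewrite (_ : _ @^-1` _ = `[0, 1[%classic); first exact: measurable_itv.
  by apply/seteqP; split => x.
pose l : {nonneg R} := NngNum (ltW L0).
pose lebL := mscale l leb.
have HE B : measurable B -> B `<=` G -> hausdorff1 B = pushforward lebL phi B.
  move=> mB BG; rewrite hausdorff1_on_curve// /pushforward /lebL /mscale/=.
  congr (_ * leb _)%E; apply/seteqP; split => x /=.
    by move=> [x01 Bx]; rewrite /phi x01.
  by rewrite /phi; case: ifPn => [//|_] /BG.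
have -> : (\int[hausdorff1]_(y in G) f y = \int[pushforward lebL phi]_(y in G) f y)%E.
  rewrite /integral.
  have nnE (g : plane -> \bar R) : (forall y, ~ G y -> g y = 0%E) ->
      forall h : {nnsfun plane >-> R}, (forall x, ((h x)%:E <= g x)%E) ->
      sintegral hausdorff1 h = sintegral (pushforward lebL phi) h.
    move=> g0 h hg; rewrite /sintegral; apply: eq_fsbigr => r _.
    have [->|r0] := eqVneq r 0; first by rewrite !mul0e.
    congr (_ * _)%E; apply: HE => [|y /= hy]; first exact: measurable_funPTI.
    apply: contrapT => /g0 gy; have := hg y; rewrite gy hy lee_fin => r_le0.
    have : 0 <= r by rewrite -hy.
    by move: r0; rewrite eq_le r_le0 => /= /negP.
  have supE (g : plane -> \bar R) : (forall y, ~ G y -> g y = 0%E) ->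
      [set sintegral hausdorff1 h | h in [set h : {nnsfun plane >-> R} |
        forall x, ((h x)%:E <= g x)%E]] =
      [set sintegral (pushforward lebL phi) h | h in [set h : {nnsfun plane >-> R} |
        forall x, ((h x)%:E <= g x)%E]].
    by move=> g0; apply/seteqP; split => _ [h hg <-]; exists h => //; rewrite (nnE g).
  by congr (ereal_sup _ - ereal_sup _)%E; apply: supE => y Gy;
    rewrite ?funeposE ?funenegE patchN ?oppe0 ?maxxx//; apply/negP; rewrite inE.
apply: etrans; first apply: (ge0_integral_pushforward mphi (mscale l leb)).
- exact: measurable_curve.
- exact: measurable_fun_curve.
- by move=> y /[!inE]; exact: f0.
have phiE : {in `[0, 1[, f \o phi =1 f \o P}.
  by move=> x x01; rewrite /= /phi x01.
rewrite phiG ge0_integral_mscale//; last 2 first.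
- apply: (eq_measurable_fun (f \o P)) => // x.
  by rewrite inE => x01; rewrite phiE.
- move=> x x01; rewrite phiE//; apply: f0; by exists x.
congr (_ * _)%E; apply: eq_integral => x; rewrite inE => x01.
by rewrite phiE.
Qed.

End param_integral.

(** * The energy of a closed curve with increasing tangent angle *)

Section frame.
Context {R : realType}.
Local Notation plane := (R * R)%type.
Variables (P : R -> plane) (Phi k : R -> R) (L : R).
Hypothesis L0 : 0 < L.
Hypothesis dP1 : forall x : R, is_derive x 1 (fun y => (P y).1) (L * cos (Phi x)).
Hypothesis dP2 : forall x : R, is_derive x 1 (fun y => (P y).2) (L * sin (Phi x)).
Hypothesis dPhi : forall x : R, is_derive x 1 Phi (k x).
Hypothesis k0 : forall x, 0 < k x.
Hypothesis P_per : forall x, P (x + 1) = P x.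
Hypothesis Phi_per : forall x, Phi (x + 1) = Phi x + 2 * pi.

(** The distance from [P t] to the tangent line at [P s], counted positively on
    the left of that line. *)
Definition tangent_dist (s t : R) : R := det2 (cos (Phi s), sin (Phi s)) (P t - P s).

(** The integrand of [W] in the parameters: the angular speed, per unit of
    arclength, of [P t] seen from [P s], over the chord to the power [alpha]. *)
Definition wkernel (alpha s t : R) : R :=
  tangent_dist t s / enorm (P s - P t) `^ (2 + alpha).

Hypothesis tangent_dist_gt0 : forall s v : R, 0 < v < 1 -> 0 < tangent_dist s (s + v).

Let continuous_P1 : continuous (fun y => (P y).1).
Proof. by move=> x; exact: is_derive_continuous (dP1 x). Qed.

Let continuous_P2 : continuous (fun y => (P y).2).
Proof. by move=> x; exact: is_derive_continuous (dP2 x). Qed.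

Let measurable_comp_fst (f : R -> R) : continuous f ->
  measurable_fun setT (fun st : R * R => f st.1).
Proof.
move=> fc; apply: (measurableT_comp (continuous_measurable_fun fc)).
exact: measurable_fst.
Qed.

Let measurable_comp_snd (f : R -> R) : continuous f ->
  measurable_fun setT (fun st : R * R => f st.2).
Proof.
move=> fc; apply: (measurableT_comp (continuous_measurable_fun fc)).
exact: measurable_snd.
Qed.

Lemma measurable_wkernel alpha :
  measurable_fun setT (fun st : R * R => wkernel alpha st.1 st.2).
Proof.
have cPhi : continuous Phi by move=> x; exact: is_derive_continuous (dPhi x).
have ccos : continuous (fun x => cos (Phi x)).
  by move=> x; exact: is_derive_continuous (is_derive_compose (is_derive_cos _) (dPhi x)).
have csin : continuous (fun x => sin (Phi x)).
  by move=> x; exact: is_derive_continuous (is_derive_compose (is_derive_sin _) (dPhi x)).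
have m1 := measurable_comp_fst continuous_P1.
have m2 := measurable_comp_snd continuous_P1.
have m3 := measurable_comp_fst continuous_P2.
have m4 := measurable_comp_snd continuous_P2.
rewrite /wkernel; apply: measurable_funM.
  apply: measurable_funB; apply: measurable_funM.
  - exact: measurable_comp_snd ccos.
  - exact: measurable_funB.
  - exact: measurable_comp_snd csin.
  - exact: measurable_funB.
under eq_fun do rewrite -powRN.
apply: (measurableT_comp (measurable_powR _)).
apply: (measurableT_comp (continuous_measurable_fun (@sqrt_continuous R))).
by apply: measurable_funD; apply: measurable_funM; apply: measurable_funB.
Qed.

Lemma angle_increasing x y : x < y -> Phi x < Phi y.
Proof. by move=> xy; apply: (is_derive_gt0_lt dPhi) => // z _. Qed.

Section gap.
Variables (alpha v : R).
Hypothesis alpha0 : 0 < alpha.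
Hypothesis v01 : 0 < v < 1.

(** The closed curve of the chords with gap [v], its velocity, and its
    components [A] along and [C] across the tangent at the foot of the chord. *)
Let z1 (x : R) : R := (P (x + v)).1 - (P x).1.
Let z2 (x : R) : R := (P (x + v)).2 - (P x).2.
Let dz1 (x : R) : R := L * (cos (Phi (x + v)) - cos (Phi x)).
Let dz2 (x : R) : R := L * (sin (Phi (x + v)) - sin (Phi x)).

Let is_derive_z1 (x : R) : is_derive x 1 z1 (dz1 x).
Proof.
apply: (is_derive_eq (is_derive_sub (is_derive_shift (dP1 (x + v))) (dP1 x))).
by rewrite /dz1 mulrBr.
Qed.

Let is_derive_z2 (x : R) : is_derive x 1 z2 (dz2 x).
Proof.
apply: (is_derive_eq (is_derive_sub (is_derive_shift (dP2 (x + v))) (dP2 x))).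
by rewrite /dz2 mulrBr.
Qed.

Let dcos (x : R) : is_derive x 1 (fun y => cos (Phi y)) (- sin (Phi x) * k x).
Proof. exact: is_derive_compose (is_derive_cos _) (dPhi x). Qed.

Let dsin (x : R) : is_derive x 1 (fun y => sin (Phi y)) (cos (Phi x) * k x).
Proof. exact: is_derive_compose (is_derive_sin _) (dPhi x). Qed.

Let A (x : R) : R := cos (Phi x) * z1 x + sin (Phi x) * z2 x.
Let C (x : R) : R := cos (Phi x) * z2 x - sin (Phi x) * z1 x.
Let r2 (x : R) : R := z1 x * z1 x + z2 x * z2 x.
Let N (x : R) : R := z1 x * dz2 x - z2 x * dz1 x.

Let CE x : C x = tangent_dist x (x + v).
Proof. by []. Qed.

Let C_gt0 x : 0 < C x.
Proof. by rewrite CE tangent_dist_gt0. Qed.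

Let AC x : A x * A x + C x * C x = r2 x.
Proof.
transitivity ((cos (Phi x) ^+ 2 + sin (Phi x) ^+ 2) * r2 x).
  by rewrite /A /C /r2; ring.
by rewrite cos2Dsin2 mul1r.
Qed.

Let r2_gt0 x : 0 < r2 x.
Proof. by rewrite -AC; have := C_gt0 x => h; nra. Qed.

Let NE x : N x = L * (tangent_dist x (x + v) + tangent_dist (x + v) x).
Proof. by rewrite /N /tangent_dist /det2 /dz1 /dz2 /z1 /z2 /=; ring. Qed.

Let tangent_dist_back x : 0 < tangent_dist (x + v) x.
Proof.
have := @tangent_dist_gt0 (x + v) (1 - v).
have -> : x + v + (1 - v) = x + 1 by ring.
rewrite /tangent_dist P_per.
by apply; case/andP: v01 => ? ?; apply/andP; split; lra.
Qed.

Let N_gt0 x : 0 < N x.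
Proof.
by rewrite NE mulr_gt0// addr_gt0 ?tangent_dist_gt0 ?tangent_dist_back.
Qed.

(** The direction of the chord up to the constant [pi / 2], measured
    continuously: it stays within a half-turn of the tangent, hence gains exactly
    one turn per period. *)
Let omega (x : R) : R := Phi x - atan (A x / C x).

Let is_derive_omega (x : R) : is_derive x 1 omega (N x / r2 x).
Proof.
have Cn0 : C x != 0 by rewrite gt_eqF.
have dA := is_derive_add (is_derive_mul (dcos x) (is_derive_z1 x))
                         (is_derive_mul (dsin x) (is_derive_z2 x)).
have dC := is_derive_sub (is_derive_mul (dcos x) (is_derive_z2 x))
                         (is_derive_mul (dsin x) (is_derive_z1 x)).
have dat := is_derive_compose (is_derive1_atan _) (is_derive_div Cn0 dA dC).
apply: (is_derive_eq (is_derive_sub (dPhi x) dat)).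
have r2n0 : r2 x != 0 by rewrite gt_eqF.
have -> : (1 + (A x / C x) ^+ 2)^-1 = C x ^+ 2 / r2 x.
  have r2n0' := r2n0; rewrite -AC in r2n0'.
  rewrite -AC; field.
  by rewrite r2n0' Cn0.
set a' := (X in (X * C x - _) / _); set c' := (X in (_ - _ * X) / _).
have E : a' * C x - A x * c' = k x * r2 x - N x.
  transitivity (k x * (A x * A x + C x * C x) -
                (cos (Phi x) ^+ 2 + sin (Phi x) ^+ 2) * N x).
    by rewrite /a' /c' /A /C /N; ring.
  by rewrite cos2Dsin2 mul1r AC.
rewrite E; field.
by rewrite r2n0 Cn0.
Qed.

Let omega_period : omega 1 - omega 0 = 2 * pi.
Proof.
have per x : C (x + 1) = C x /\ A (x + 1) = A x.
  by rewrite /C /A /z1 /z2 addrAC !P_per Phi_per mulr_natl cosD2pi sinD2pi.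
have [c0 a0] := per 0; have := Phi_per 0; rewrite add0r in c0 a0 *.
by rewrite /omega c0 a0 => ->; ring.
Qed.

Let beta (x : R) : R := (Phi (x + v) - Phi x) / 2.

Let beta_itv x : 0 <= beta x <= pi.
Proof.
have /andP[v0 v1] := v01.
have h1 : Phi x < Phi (x + v) by apply: angle_increasing; rewrite ltrDl.
have h2 : Phi (x + v) < Phi (x + 1) by apply: angle_increasing; rewrite ltrD2l.
rewrite Phi_per in h2.
by rewrite /beta; apply/andP; split; lra.
Qed.

Let dbeta (x : R) : is_derive x 1 beta ((k (x + v) - k x) / 2).
Proof.
apply: (is_derive_eq (is_derive_mul (is_derive_sub (is_derive_shift (dPhi (x + v))) (dPhi x))
  (is_derive_const (2^-1) x))).
by rewrite mulr0 addr0.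
Qed.

(** The difference of two unit vectors at angle [2 * beta] has length
    [2 * sin beta]. *)
Let dz_norm x : dz1 x ^+ 2 + dz2 x ^+ 2 = (2 * L * sin (beta x)) ^+ 2.
Proof.
have -> : dz1 x ^+ 2 + dz2 x ^+ 2 =
    L ^+ 2 * (2 - 2 * cos (Phi (x + v) - Phi x)).
  rewrite cosB.
  transitivity (L ^+ 2 * ((cos (Phi (x + v)) ^+ 2 + sin (Phi (x + v)) ^+ 2) +
    (cos (Phi x) ^+ 2 + sin (Phi x) ^+ 2) -
    2 * (cos (Phi (x + v)) * cos (Phi x) + sin (Phi (x + v)) * sin (Phi x)))).
    by rewrite /dz1 /dz2; ring.
  by rewrite !cos2Dsin2.
have -> : Phi (x + v) - Phi x = beta x *+ 2.
  by rewrite /beta; lra.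
rewrite cos_mulr2n.
have -> : cos (beta x) ^+ 2 = 1 - sin (beta x) ^+ 2 by rewrite -(cos2Dsin2 (beta x)); ring.
by rewrite -mulr_natl; ring.
Qed.

(** The angular part of the velocity is at most the whole velocity. *)
Let r_omega_le x : Num.sqrt (r2 x) * (N x / r2 x) <= 2 * L * sin (beta x).
Proof.
have r0 : 0 < Num.sqrt (r2 x) by rewrite sqrtr_gt0.
have s0 : 0 <= 2 * L * sin (beta x).
  by rewrite mulr_ge0 ?sin_ge0_pi ?in_itv// mulr_ge0// ltW.
have r2E : r2 x = Num.sqrt (r2 x) ^+ 2 by rewrite sqr_sqrtr// ltW.
have -> : Num.sqrt (r2 x) * (N x / r2 x) = N x / Num.sqrt (r2 x).
  move: r0 r2E; set r := Num.sqrt _ => r0 ->; field.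
  by rewrite gt_eqF.
rewrite ler_pdivrMr// -(@ler_pXn2r _ 2) ?nnegrE//; last 2 first.
- exact: ltW.
- by rewrite mulr_ge0// ltW.
rewrite exprMn -dz_norm sqr_sqrtr; last exact: ltW.
rewrite /N /r2.
rewrite -subr_ge0 (_ : _ - _ = (z1 x * dz1 x + z2 x * dz2 x) ^+ 2) ?sqr_ge0//.
ring.
Qed.

(** The chord that the circle of length [L] has for the gap [v]. *)
Let a : R := L / pi * sin (pi * v).

Let a_gt0 : 0 < a.
Proof.
have /andP[v0 v1] := v01.
rewrite mulr_gt0 ?divr_gt0 ?pi_gt0// sin_gt0_pi//.
by rewrite mulr_gt0 ?pi_gt0//= gtr_pMr ?pi_gt0.
Qed.

Let r2_enorm s : enorm (P s - P (s + v)) = Num.sqrt (r2 s).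
Proof. by rewrite /enorm /dot /r2 /z1 /z2 /=; congr Num.sqrt; ring. Qed.

Let kernelE s : wkernel alpha s (s + v) + wkernel alpha (s + v) s =
  L^-1 * (Num.sqrt (r2 s) `^ (- alpha) * (N s / r2 s)).
Proof.
have r0 : 0 < Num.sqrt (r2 s) by rewrite sqrtr_gt0.
rewrite /wkernel (enorm_sym (P (s + v))) r2_enorm -mulrDl.
rewrite powRD; last by apply/implyP => _; rewrite gt_eqF.
rewrite powRN (_ : _ `^ 2 = r2 s); last first.
  by rewrite powR_mulrn ?ltW// sqr_sqrtr ?ltW.
rewrite NE (addrC (tangent_dist (s + v) s)); field.
by rewrite !gt_eqF// powR_gt0.
Qed.

(** Jensen's inequality for the probability [omega' / (2 * pi)], in tangent-line
    form: the lower bound [f] of the integrand has an explicit primitive [F],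
    and only the increments of [omega] and of the primitive [X] of the tangent
    angle over one period enter. *)
Lemma fixed_gap_bound :
  ((2 * pi / L * a `^ (- alpha))%:E <= \int[@lebesgue_measure R]_(s in `[0%R, 1%R[)
     (wkernel alpha s (s + v) + wkernel alpha (s + v) s)%:E)%E.
Proof.
have [X dX] := @antiderivative R Phi (fun x => is_derive_continuous (dPhi x)).
have Lp : 2 * L * sin (pi * v) = 2 * pi * a.
  rewrite /a; have : (pi : R) != 0 by rewrite gt_eqF ?pi_gt0.
  by generalize (sin (pi * v)) (@pi R) => S p p0; field.
pose c1 := (1 + alpha) * a `^ (- alpha).
pose c2 := alpha * a `^ (- alpha - 1) * (2 * L).
pose F x := L^-1 * (c1 * omega x - c2 * (sin (pi * v) * x +
  cos (pi * v) * ((X (x + v) - X x) / 2 - pi * v * x))).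
pose f x := L^-1 * (c1 * (N x / r2 x) - c2 * (sin (pi * v) +
  cos (pi * v) * (beta x - pi * v))).
have dF (x : R) : is_derive x 1 F (f x).
  have dlin (c : R) : is_derive x 1 (fun y : R => c * y) c.
    apply: (is_derive_eq (is_derive_mul (is_derive_const c x) (is_derive_ident x))).
    by rewrite mul0r add0r mulr1.
  have dhalf := is_derive_mul (is_derive_sub (is_derive_shift (dX (x + v))) (dX x))
    (is_derive_const (2^-1) x).
  have dcst (c : R) g g' : is_derive x 1 g g' -> is_derive x 1 (fun y : R => c * g y) (c * g').
    move=> dg; apply: (is_derive_eq (is_derive_mul (is_derive_const c x) dg)).
    by rewrite mul0r add0r.
  have := dcst L^-1 _ _ (is_derive_sub (dcst c1 _ _ (is_derive_omega x))
    (dcst c2 _ _ (is_derive_add (dlin (sin (pi * v)))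
      (dcst (cos (pi * v)) _ _ (is_derive_sub dhalf (dlin (pi * v))))))).
  by rewrite mulr0 addr0.
have fc : continuous f.
  have ddz1 (x : R) : is_derive x 1 dz1 _ := is_derive_mul (is_derive_const L x)
    (is_derive_sub (is_derive_shift (dcos (x + v))) (dcos x)).
  have ddz2 (x : R) : is_derive x 1 dz2 _ := is_derive_mul (is_derive_const L x)
    (is_derive_sub (is_derive_shift (dsin (x + v))) (dsin x)).
  move=> x.
  have dN := is_derive_sub (is_derive_mul (is_derive_z1 x) (ddz2 x))
    (is_derive_mul (is_derive_z2 x) (ddz1 x)).
  have dr2 := is_derive_add (is_derive_mul (is_derive_z1 x) (is_derive_z1 x))
    (is_derive_mul (is_derive_z2 x) (is_derive_z2 x)).
  have r2n0 : r2 x != 0 by rewrite gt_eqF.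
  have cN := is_derive_continuous (is_derive_div r2n0 dN dr2).
  have cb := is_derive_continuous (dbeta x).
  apply: cvgM; first exact: cvg_cst.
  apply: cvgB; apply: cvgM; [exact: cvg_cst|exact: cN|exact: cvg_cst|].
  apply: cvgD; first exact: cvg_cst.
  apply: cvgM; first exact: cvg_cst.
  by apply: cvgB; [exact: cb|exact: cvg_cst].
have -> : 2 * pi / L * a `^ (- alpha) = F 1 - F 0.
  (* the tangent angle has mean increment [2 * pi * v] over the gap [v] *)
  have XX : X (1 + v) - X 1 - (X v - X 0) = 2 * pi * v.
    pose Y y := X (1 + y) - X y - 2 * pi * y.
    have dY (y : R) : is_derive y 1 Y 0.
      have dX1 : is_derive y 1 (fun y => X (1 + y)) (Phi (y + 1)).
        under eq_fun do rewrite addrC.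
        exact: is_derive_shift.
      have dlin := is_derive_mul (is_derive_const (2 * pi) y) (is_derive_ident y).
      apply: (is_derive_eq (is_derive_sub (is_derive_sub dX1 (dX y)) dlin)).
      by rewrite Phi_per; ring.
    have := is_derive0_const dY v 0; rewrite /Y addr0; lra.
  have -> : F 1 - F 0 = L^-1 * (c1 * (omega 1 - omega 0) - c2 * (sin (pi * v) +
      cos (pi * v) * ((X (1 + v) - X 1 - (X v - X 0)) / 2 - pi * v))).
    by rewrite /F add0r; ring.
  rewrite XX omega_period (_ : 2 * pi * v / 2 - pi * v = 0); last by lra.
  have -> : c1 * (2 * pi) - c2 * (sin (pi * v) + cos (pi * v) * 0) =
      c1 * (2 * pi) - alpha * a `^ (- alpha - 1) * (2 * L * sin (pi * v)).
    by rewrite /c2; ring.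
  rewrite Lp (_ : a `^ (- alpha - 1) = a `^ (- alpha) / a); last first.
    rewrite powRD; last by apply/implyP => _; rewrite gt_eqF.
    by rewrite powR_inv1// ltW.
  rewrite /c1; field.
  by rewrite !gt_eqF.
apply: (integral_ge_increment dF) => //.
- have mw (f1 f2 : R -> R) : measurable_fun setT f1 -> measurable_fun setT f2 ->
      measurable_fun setT (fun s => wkernel alpha (f1 s) (f2 s)).
    move=> m1 m2.
    exact: (measurableT_comp (measurable_wkernel alpha) (measurable_fun_pair m1 m2)).
  have mv : measurable_fun setT (fun s : R => s + v) by exact: measurable_funD.
  apply: (@measurable_funS _ _ _ _ setT) => //.
  by apply: measurable_funD; apply: mw.
- move=> s; rewrite kernelE ltW// mulr_gt0 ?invr_gt0// mulr_gt0 ?divr_gt0//.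
  by rewrite powR_gt0// sqrtr_gt0.
- move=> s; rewrite kernelE /f ler_pM2l ?invr_gt0//.
  have r0 : 0 < Num.sqrt (r2 s) by rewrite sqrtr_gt0.
  have om0 : 0 < N s / r2 s by rewrite divr_gt0.
  have st : sin (beta s) <= sin (pi * v) + cos (pi * v) * (beta s - pi * v).
    apply: sin_tangent => //; have /andP[v0 v1] := v01.
    apply/andP; split; first by rewrite mulr_ge0 ?pi_ge0// ltW.
    by rewrite ger_pMr ?pi_gt0// ltW.
  have ap : 0 <= alpha * a `^ (- alpha - 1) by rewrite mulr_ge0 ?powR_ge0// ltW.
  have h1 := powR_tangent alpha0 a_gt0 r0.
  have h2 := r_omega_le s.
  rewrite -(ler_pM2r om0) in h1; apply: le_trans h1.
  have h3 := ler_wpM2l ap h2.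
  have L2 : 0 <= 2 * L by rewrite mulr_ge0// ltW.
  have h4 := ler_wpM2l ap (ler_wpM2l L2 st).
  rewrite /c1 /c2; move: h3 h4.
  by generalize (alpha * a `^ (- alpha - 1)) (N s / r2 s) => K om h3 h4; lra.
Qed.

End gap.
End frame.

Section frame.
Context {R : realType}.
Local Notation plane := (R * R)%type.
Local Notation leb := (@lebesgue_measure R).
Variables (P : R -> plane) (Phi k : R -> R) (L : R).
Hypothesis L0 : 0 < L.
Hypothesis dP1 : forall x : R, is_derive x 1 (fun y => (P y).1) (L * cos (Phi x)).
Hypothesis dP2 : forall x : R, is_derive x 1 (fun y => (P y).2) (L * sin (Phi x)).
Hypothesis dPhi : forall x : R, is_derive x 1 Phi (k x).
Hypothesis k0 : forall x, 0 < k x.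
Hypothesis kc : continuous k.
Hypothesis P_per : forall x, P (x + 1) = P x.
Hypothesis Phi_per : forall x, Phi (x + 1) = Phi x + 2 * pi.
Hypothesis tangent_dist_ge0 : forall s t, 0 <= tangent_dist P Phi s t.
Hypothesis tangent_dist_gt0 : forall s v : R, 0 < v < 1 -> 0 < tangent_dist P Phi s (s + v).

Local Notation w := (wkernel P Phi).

Lemma wkernel_ge0 alpha s t : 0 <= w alpha s t.
Proof. by rewrite /wkernel divr_ge0// powR_ge0. Qed.

Lemma wkernel_per alpha s t :
  w alpha (s + 1) t = w alpha s t /\ w alpha s (t + 1) = w alpha s t.
Proof.
rewrite /wkernel /tangent_dist !P_per Phi_per mulr_natl.
by rewrite cosD2pi sinD2pi.
Qed.

(** The energy of a circle, without its explicit factors. *)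
Definition circle_energy (alpha : R) : \bar R :=
  (\int[leb]_(v in `[0%R, 1%R[) (sin (pi * v) `^ (- alpha))%:E)%E.

Let f alpha (v : R) := 2 * pi / L * (L / pi * sin (pi * v)) `^ (- alpha).

Let Lpi0 : 0 < L / pi. Proof. by rewrite divr_gt0 ?pi_gt0. Qed.

Let f_ge0 alpha v : 0 <= f alpha v.
Proof. by rewrite /f mulr_ge0 ?powR_ge0// divr_ge0 ?mulr_ge0 ?pi_ge0// ltW. Qed.

Let f0 alpha : 0 < alpha -> f alpha 0 = 0.
Proof.
by move=> al0; rewrite /f mulr0 sin0 mulr0 powR0 ?oppr_eq0 ?gt_eqF// mulr0.
Qed.

Let c_ge0 alpha : 0 <= pi / L * (L / pi) `^ (- alpha).
Proof. by rewrite mulr_ge0 ?powR_ge0// divr_ge0 ?pi_ge0// ltW. Qed.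

Let fE alpha (v : R) : v \in `[0, 1[ ->
  f alpha v = 2 * (pi / L * (L / pi) `^ (- alpha)) * sin (pi * v) `^ (- alpha).
Proof.
move=> v01; rewrite /f (powRM _ (ltW Lpi0) (sin_pi_ge0 v01)).
by rewrite !mulrA.
Qed.

Let measurable_f alpha : measurable_fun (`[0, 1[%classic : set R) (fun v => (f alpha v)%:E).
Proof.
apply: (@measurable_funS _ _ _ _ setT) => //; apply/measurable_EFinP.
apply: measurable_funM => //.
apply: (measurableT_comp (measurable_powR _)).
apply: measurable_funM => //.
apply: continuous_measurable_fun => x.
apply: (@continuous_comp _ _ _ (fun v => pi * v) sin); last exact: continuous_sin.
by apply: cvgM; [exact: cvg_cst|exact: cvg_id].
Qed.

Let integral_f alpha :
  (\int[leb]_(v in `[0%R, 1%R[) (f alpha v)%:E =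
   2%:E * ((pi / L * (L / pi) `^ (- alpha))%:E * circle_energy alpha))%E.
Proof.
rewrite muleA -EFinM /circle_energy -ge0_integralZl//.
- by apply: eq_integral => v; rewrite inE => v01; rewrite fE.
- apply/measurable_EFinP.
  exact: (measurable_funS measurableT (@subsetT _ _) (measurable_sin_powR alpha)).
- by move=> v _; rewrite lee_fin powR_ge0.
- by rewrite lee_fin mulr_ge0.
Qed.

(** Adding the two orders of integration makes the kernel symmetric, after which
    [fixed_gap_bound] applies on each diagonal of the torus. *)
Lemma double_integral_wkernel_ge alpha : 0 < alpha ->
  ((pi / L * (L / pi) `^ (- alpha))%:E * circle_energy alpha <=
   \int[leb]_(s in `[0%R, 1%R[) \int[leb]_(t in `[0%R, 1%R[) (w alpha s t)%:E)%E.
Proof.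
move=> al0.
set J := (X in (_ <= X)%E).
pose g st := (w alpha st.1 st.2)%:E.
pose g' st := (w alpha st.2 st.1)%:E.
have mg : measurable_fun setT g.
  by apply/measurable_EFinP; exact: (measurable_wkernel dP1 dP2 dPhi).
have mg' : measurable_fun setT g'.
  exact: (measurableT_comp mg (measurable_fun_pair measurable_snd measurable_fst)).
have g0 st : (0 <= g st)%E by rewrite lee_fin wkernel_ge0.
have g'0 st : (0 <= g' st)%E by rewrite lee_fin wkernel_ge0.
have JE : J = (\int[leb]_(s in `[0%R, 1%R[) \int[leb]_(t in `[0%R, 1%R[) g' (s, t))%E.
  by rewrite fubini_tonelli_square.
have mgs s : measurable_fun (`[0, 1[%classic : set R) (fun t => g (s, t)).
  exact: (measurable_funS measurableT (@subsetT _ _) (measurable_fun_pair2 s mg)).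
have mgs' s : measurable_fun (`[0, 1[%classic : set R) (fun t => g' (s, t)).
  exact: (measurable_funS measurableT (@subsetT _ _) (measurable_fun_pair2 s mg')).
have mI : measurable (`[0, 1[%classic : set R) by exact: measurable_itv.
pose inner (h : R * R -> \bar R) s := (\int[leb]_(t in `[0%R, 1%R[) h (s, t))%E.
have inner0 h s : (forall st, 0 <= h st)%E -> (0 <= inner h s)%E.
  by move=> h0; apply: integral_ge0 => t _; exact: h0.
have minner h : measurable_fun setT h -> (forall st, 0 <= h st)%E ->
    measurable_fun (`[0, 1[%classic : set R) (inner h).
  move=> mh h0.
  exact: (measurable_funS measurableT (@subsetT _ _) (measurable_fun_integral_period mh h0)).
have mgg' : measurable_fun setT (g \+ g')%E by exact: emeasurable_funD.
have gg'0 st : (0 <= (g \+ g')%E st)%E by rewrite adde_ge0.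
have gg'per s t : ((g \+ g')%E (s, t + 1)%R = (g \+ g')%E (s, t))%E.
  by rewrite /g /g'/= (wkernel_per _ _ _).1 (wkernel_per _ _ _).2.
have J2 : (J + J = \int[leb]_(v in `[0%R, 1%R[) \int[leb]_(s in `[0%R, 1%R[)
    (w alpha s (v + s) + w alpha (v + s) s)%:E)%E.
  rewrite {2}JE /J.
  transitivity (\int[leb]_(s in `[0%R, 1%R[) (inner g s + inner g' s))%E.
    by rewrite (ge0_integralD leb mI (fun s _ => inner0 g s g0) (minner _ mg g0)
      (fun s _ => inner0 g' s g'0) (minner _ mg' g'0)).
  rewrite -[RHS](integral_torus_shear mgg' gg'0 gg'per).
  apply: eq_integral => s _.
  by rewrite (ge0_integralD leb mI (fun t _ => g0 (s, t)) (mgs s)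
    (fun t _ => g'0 (s, t)) (mgs' s)).
pose G vs := (w alpha vs.2 (vs.1 + vs.2) + w alpha (vs.1 + vs.2) vs.2)%:E.
have mG : measurable_fun setT G.
  have sum : measurable_fun setT (fun vs : R * R => vs.1 + vs.2).
    by apply: measurable_funD; [exact: measurable_fst|exact: measurable_snd].
  have mG1 := measurableT_comp mg (measurable_fun_pair measurable_snd sum).
  have mG2 := measurableT_comp mg (measurable_fun_pair sum measurable_snd).
  by rewrite /G; exact: emeasurable_funD mG1 mG2.
have G0 x : (0 <= G x)%E by rewrite lee_fin addr_ge0 ?wkernel_ge0.
have lower : (\int[leb]_(v in `[0%R, 1%R[) (f alpha v)%:E <= J + J)%E.
  rewrite J2; apply: (ge0_le_integral leb mI).
  - by move=> v _; rewrite lee_fin f_ge0.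
  - exact: measurable_f.
  - exact: (minner _ mG G0).
  - move=> v; rewrite /= in_itv/= => /andP[v0 v1].
    move: v0; rewrite le_eqVlt => /predU1P[<-|v0].
      by rewrite (f0 al0); exact: (inner0 G 0 G0).
    have v01 : 0 < v < 1 by rewrite v0.
    have -> : (\int[leb]_(s in `[0%R, 1%R[)
        (w alpha s (v + s) + w alpha (v + s) s)%:E =
      \int[leb]_(s in `[0%R, 1%R[) (w alpha s (s + v) + w alpha (s + v) s)%:E)%E.
      by apply: eq_integral => s _; rewrite (addrC v).
    exact: (fixed_gap_bound L0 dP1 dP2 dPhi k0 P_per Phi_per tangent_dist_gt0 al0 v01).
have JJ : (J + J = 2%:E * J)%E by rewrite mule_natl mule2n.
rewrite JJ integral_f in lower; move: lower.
by rewrite lee_pmul2l// lte_fin.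
Qed.

End frame.

Section frame_measure.
Context {R : realType}.
Local Notation plane := (R * R)%type.
Local Notation leb := (@lebesgue_measure R).
Variables (P : R -> plane) (Phi k : R -> R) (L : R).
Hypothesis L0 : 0 < L.
Hypothesis dP1 : forall x : R, is_derive x 1 (fun y => (P y).1) (L * cos (Phi x)).
Hypothesis dP2 : forall x : R, is_derive x 1 (fun y => (P y).2) (L * sin (Phi x)).
Hypothesis dPhi : forall x : R, is_derive x 1 Phi (k x).
Hypothesis k0 : forall x, 0 < k x.
Hypothesis kc : continuous k.
Hypothesis P_per : forall x, P (x + 1) = P x.
Hypothesis tangent_dist_ge0 : forall s t, 0 <= tangent_dist P Phi s t.
Hypothesis tangent_dist_gt0 : forall s v : R, 0 < v < 1 -> 0 < tangent_dist P Phi s (s + v).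

Lemma curve_injective : {in `[0, 1[ &, injective P}.
Proof.
have key s t : 0 <= s -> s < t -> t < 1 -> P s <> P t.
  move=> s0 st t1 Pst.
  have := @tangent_dist_gt0 s (t - s); rewrite (_ : s + (t - s) = t); last by ring.
  rewrite /tangent_dist Pst subrr /det2/= !mulr0 subrr ltxx => H.
  suff : false by []. 
  by apply: H; apply/andP; split; lra.
move=> s t; rewrite !in_itv/= => /andP[s0 s1] /andP[t0 t1] Pst.
have [st|st|//] := ltgtP s t.
  by have := key _ _ s0 st t1 Pst.
by have := key _ _ t0 st s1 (esym Pst).
Qed.

Lemma continuous_curve : continuous P.
Proof.
move=> x.
have -> : P = fun y => ((P y).1, (P y).2) by apply/funext => y; case: (P y).
have h1 := is_derive_continuous (dP1 x).
have h2 := is_derive_continuous (dP2 x).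
exact: (cvg_pair h1 h2).
Qed.

(** The mean value theorem for the component of the curve along [(c, s)]. *)
Lemma chord_speed c s (x y : R) : x < y -> exists2 z, x < z < y &
  c * (P y - P x).1 + s * (P y - P x).2 =
  L * (c * cos (Phi z) + s * sin (Phi z)) * (y - x).
Proof.
move=> xy.
have dlin (f f' : R -> R) (a : R) : (forall x : R, is_derive x 1 f (f' x)) ->
    forall x : R, is_derive x 1 (fun y => a * f y) (a * f' x).
  move=> df z; apply: (is_derive_eq (is_derive_mul (is_derive_const a z) (df z))).
  by rewrite mul0r add0r.
have d z := is_derive_add (dlin _ _ c dP1 z) (dlin _ _ s dP2 z).
have [z zxy E] := mean_value d xy; exists z => //=.
transitivity (c * (P y).1 + s * (P y).2 - (c * (P x).1 + s * (P x).2)); first by ring.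
by rewrite E; ring.
Qed.

Lemma curve_lipschitz s t : enorm (P t - P s) <= L * `|t - s|.
Proof.
wlog st : s t / s < t.
  move=> H; have [st|ts|->] := ltgtP s t; first exact: H.
    by rewrite enorm_sym distrC; exact: H.
  by rewrite !subrr normr0 mulr0 /enorm /dot/= mul0r addr0 sqrtr0.
set z := P t - P s.
have [z0|z0] := eqVneq (enorm z) 0; first by rewrite z0 mulr_ge0// ltW.
have zp : 0 < enorm z by rewrite lt_neqAle eq_sym z0 enorm_ge0.
have zz : z.1 * z.1 + z.2 * z.2 = enorm z ^+ 2.
  by rewrite /enorm sqr_sqrtr// /dot addr_ge0// -expr2 sqr_ge0.
have [x _ E] := chord_speed (z.1 / enorm z) (z.2 / enorm z) st.
have -> : enorm z = z.1 / enorm z * z.1 + z.2 / enorm z * z.2.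
  apply: (mulIf z0); rewrite -expr2 -zz; field.
  by [].
rewrite E gtr0_norm ?subr_gt0// ler_pM2r ?subr_gt0// ger_pMr//.
have := @proj_le_enorm R (cos (Phi x), sin (Phi x)) (z.1 / enorm z) (z.2 / enorm z).
have -> : enorm (cos (Phi x), sin (Phi x)) = 1.
  by rewrite /enorm /dot/= -!expr2 cos2Dsin2 sqrtr1.
move=> H.
apply: le_trans (ler_norm _) (H _).
by rewrite !expr_div_n -mulrDl !expr2 zz -expr2 divff// expf_neq0.
Qed.

(** The projection of the chord on the tangent at one end is already almost as
    long as the arc, since the tangent turns little in between. *)
Lemma curve_almost_isometric (e : R) : 0 < e -> exists2 tau : R, 0 < tau &
  forall s t : R, s \in `[0, 1] -> t \in `[0, 1] -> `|t - s| < tau ->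
    (1 - e) * (L * `|t - s|) <= enorm (P t - P s).
Proof.
move=> e0.
have kcs : {within `[0, 1], continuous k} by exact: continuous_subspaceT.
have [m _ km] := EVT_max ler01 kcs.
pose M := `|k m| + 1.
have M0 : 0 < M by rewrite ltr_wpDl.
exists (e / M); first by rewrite divr_gt0.
move=> s t; wlog st : s t / s < t.
  move=> H s01 t01; have [st|ts|->] := ltgtP s t; first exact: H.
    by rewrite enorm_sym distrC; exact: H.
  by rewrite subrr normr0 !mulr0 enorm_ge0.
rewrite !in_itv/= => /andP[s0 s1] /andP[t0 t1]; rewrite gtr0_norm ?subr_gt0// => tst.
have [x /andP[sx xt] E] := chord_speed (cos (Phi s)) (sin (Phi s)) st.
have cs := cos2Dsin2 (Phi s).
apply: le_trans (@proj_le_enorm R (P t - P s) _ _ cs).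
apply: le_trans (ler_norm _); rewrite E.
have [y /andP[sy yx] Ey] := mean_value dPhi sx.
have ky : k y <= M.
  have y01 : y \in `[0, 1] by rewrite in_itv/=; apply/andP; split; lra.
  by rewrite /M; have := km _ y01; have := ler_norm (k m); lra.
have small : Phi x - Phi s <= e.
  rewrite Ey (@le_trans _ _ (M * (t - s)))//.
    apply: (@le_trans _ _ (M * (x - s))).
      by rewrite ler_pM2r ?subr_gt0.
    by rewrite ler_pM2l//; lra.
  by rewrite mulrC -ler_pdivlMr// ltW.
have Phi_ge : 0 <= Phi x - Phi s by rewrite Ey ltW// mulr_gt0// subr_gt0.
have := cos_ge_1B (Phi x - Phi s); rewrite ger0_norm// cosB => h.
set Q := (X in _ <= L * X * _).
have -> : L * Q * (t - s) = Q * (L * (t - s)) by ring.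
by rewrite ler_pM2r ?mulr_gt0 ?subr_gt0// /Q; lra.
Qed.

Lemma curve_per_int (n : int) x : P (x + n%:~R) = P x.
Proof.
have per_nat m y : P (y + m%:R) = P y.
  elim: m => [|m IH]; first by rewrite addr0.
  by rewrite -natr1 addrA P_per.
case: n => n; first exact: per_nat.
by rewrite NegzE mulrNz -[in LHS](per_nat n.+1) subrK.
Qed.

Lemma range_one_period : range P = P @` `[0, 1[.
Proof.
apply/seteqP; split => [_ [x _ <-]|_ [x _ <-]]; last by exists x.
exists (x - (Num.floor x)%:~R).
  by rewrite /= in_itv/= subr_ge0 floor_le ltrBlDl -intrD1 lt_succ_floor.
by rewrite -[RHS](curve_per_int (- Num.floor x)) mulrNz.
Qed.

Let P10 : P 1 = P 0. Proof. by rewrite -[1]add0r P_per. Qed.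

Section body.
Variable K : set plane.
Hypothesis PK : range P = boundary K.

Lemma Per_curve : Per K = L%:E.
Proof.
rewrite /Per -PK range_one_period.
have mG := measurable_curve continuous_curve P10.
rewrite (hausdorff1_on_curve continuous_curve L0 curve_lipschitz curve_injective curve_almost_isometric)//.
rewrite (_ : _ `&` _ = `[0, 1[%classic).
  by rewrite lebesgue_measure_itv/= lte_fin ltr01 sube0 mule1.
by apply/setIidl => x x01; exists x.
Qed.

Lemma W_curve alpha :
  (forall t, outward_normal K (P t) = (sin (Phi t), - cos (Phi t))) ->
  W alpha K = ((L * L)%:E * \int[leb]_(s in `[0%R, 1%R[) \int[leb]_(t in `[0%R, 1%R[)
     (wkernel P Phi alpha s t)%:E)%E.
Proof.
move=> nuE.
pose g st := (wkernel P Phi alpha st.1 st.2)%:E.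
have mg : measurable_fun setT g.
  by apply/measurable_EFinP; exact: (measurable_wkernel dP1 dP2 dPhi).
have g0 st : (0 <= g st)%E by rewrite lee_fin; exact: wkernel_ge0.
pose f x y := (dot (y - x) (outward_normal K y) / enorm (x - y) `^ (2 + alpha))%:E.
have fE s t : f (P s) (P t) = g (s, t).
  rewrite /f /g /wkernel /tangent_dist nuE /=; congr (_ / _)%:E.
  by rewrite /dot /det2 /=; ring.
have G0 y s : (P @` `[0, 1[) y -> (0 <= f (P s) y)%E.
  by move=> [t _ <-]; rewrite fE.
rewrite /W -PK range_one_period.
pose inner x := (\int[hausdorff1]_(y in P @` `[0%R, 1%R[) f x y)%E.
have innerE s : inner (P s) = (L%:E * \int[leb]_(t in `[0%R, 1%R[) g (s, t))%E.
  have fP : f (P s) \o P = (fun t => g (s, t)) by apply/funext => t; exact: fE.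
  rewrite /inner (integral_hausdorff1_curve continuous_curve L0 curve_lipschitz curve_injective curve_almost_isometric P10).
  - by congr (_ * _)%E; apply: eq_integral => t _; rewrite fE.
  - rewrite fP.
    exact: (measurable_funS measurableT (@subsetT _ _) (measurable_fun_pair2 s mg)).
  - by move=> y; exact: G0.
rewrite -[LHS]/(\int[hausdorff1]_(x in P @` `[0%R, 1%R[) inner x)%E.
pose I s := (\int[leb]_(t in `[0%R, 1%R[) g (s, t))%E.
have mI : measurable_fun setT I by exact: (measurable_fun_integral_period mg g0).
have I0 s : (0 <= I s)%E by apply: integral_ge0 => t _; exact: g0.
have innerP : inner \o P = (fun s => L%:E * I s)%E.
  by apply/funext => s; exact: innerE.
rewrite (integral_hausdorff1_curve continuous_curve L0 curve_lipschitz curve_injective curve_almost_isometric P10); last 2 first.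
- rewrite innerP; apply: (measurable_funS measurableT (@subsetT _ _)).
  exact: measurable_funeM.
- move=> _ [s _ <-]; rewrite innerE; apply: mule_ge0; last exact: I0.
  by rewrite lee_fin ltW.
transitivity (L%:E * \int[leb]_(s in `[0%R, 1%R[) (L%:E * I s))%E.
  by congr (_ * _)%E; apply: eq_integral => s _; rewrite innerE.
have mIs := measurable_funS measurableT (@subsetT _ (`[0, 1[%classic : set R)) mI.
rewrite (ge0_integralZl leb (measurable_itv _) mIs (fun s _ => I0 s)).
  by rewrite muleA -EFinM.
by rewrite lee_fin ltW.
Qed.

End body.
End frame_measure.

(** * Convex bodies bounded by such a curve *)

Section convex_plane.
Context {R : realType}.
Local Notation plane := (R * R)%type.
Variable K : set plane.
Hypothesis cK : convex_set (K : set (convex_lmodType plane)).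

Lemma convex_combination (a b : plane) (x y : R) : K a -> K b ->
  0 <= x -> 0 <= y -> 0 < x + y ->
  K ((x * a.1 + y * b.1) / (x + y), (x * a.2 + y * b.2) / (x + y)).
Proof.
move=> Ka Kb x0 y0 xy.
have l0 : 0 <= x / (x + y) by rewrite divr_ge0// ltW.
have l1 : x / (x + y) <= 1 by rewrite ler_pdivrMr// mul1r lerDl.
have := cK (Itv01 l0 l1) (mem_set Ka) (mem_set Kb); rewrite inE.
congr K; case: a {Ka} => a1 a2; case: b {Kb} => b1 b2.
have n0 : x + y != 0 by rewrite gt_eqF.
rewrite /conv/= /unstable.onem; congr (_, _).
  by change (x / (x + y) * a1 + (1 - x / (x + y)) * b1 = (x * a1 + y * b1) / (x + y)); field.
by change (x / (x + y) * a2 + (1 - x / (x + y)) * b2 = (x * a2 + y * b2) / (x + y)); field.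
Qed.

(** The three determinants are the unnormalized barycentric coordinates of [p];
    they stay positive near [p]. *)
Lemma interior_triangle (a b c p : plane) : K a -> K b -> K c ->
  0 < det2 (a - p) (b - p) -> 0 < det2 (b - p) (c - p) -> 0 < det2 (c - p) (a - p) ->
  interior K p.
Proof.
move=> Ka Kb Kc abp bcp cap.
have det_near (u v : plane) : 0 < det2 (u - p) (v - p) ->
    \forall q \near p, 0 < det2 (u - q) (v - q).
  move=> h.
  have fst_c : continuous (fun q : plane => q.1) by move=> [? ?]; exact: cvg_fst.
  have snd_c : continuous (fun q : plane => q.2) by move=> [? ?]; exact: cvg_snd.
  have dc : {for p, continuous (fun q : plane => det2 (u - q) (v - q))}.
    rewrite /det2 /=; apply: cvgB; apply: cvgM; apply: cvgB;
      by [exact: cvg_cst|exact: fst_c|exact: snd_c].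
  exact: (dc _ (lt_nbhsr h)).
have h1 := det_near _ _ abp; have h2 := det_near _ _ bcp; have h3 := det_near _ _ cap.
have : nbhs p K; last by [].
apply: filterS3 h1 h2 h3 => q w0 u0 v0.
set w := det2 (a - q) (b - q) in w0; set u := det2 (b - q) (c - q) in u0.
set v := det2 (c - q) (a - q) in v0.
have vw : 0 < v + w by rewrite addr_gt0.
have Kd := convex_combination Kb Kc (ltW v0) (ltW w0) vw.
have uvw : 0 < u + (v + w) by rewrite addr_gt0.
have := convex_combination Ka Kd (ltW u0) (ltW vw) uvw.
rewrite /= ![(v + w) * (_ / _)]mulrC !divfK ?gt_eqF//.
congr K; case: q @w @u @v w0 u0 v0 vw Kd uvw => q1 q2 w u v w0 u0 v0 vw Kd uvw.
have n0 : u + (v + w) != 0 by rewrite gt_eqF.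
by congr (_, _); apply: (mulIf n0); rewrite divfK// /u /v /w /det2 /=; ring.
Qed.

End convex_plane.

Section geometry.
Context {R : realType}.
Local Notation plane := (R * R)%type.
Variables (P : R -> plane) (Phi k : R -> R) (L : R) (K : set plane).
Hypothesis L0 : 0 < L.
Hypothesis dP1 : forall x : R, is_derive x 1 (fun y => (P y).1) (L * cos (Phi x)).
Hypothesis dP2 : forall x : R, is_derive x 1 (fun y => (P y).2) (L * sin (Phi x)).
Hypothesis dPhi : forall x : R, is_derive x 1 Phi (k x).

Let T (x : R) : plane := (cos (Phi x), sin (Phi x)).

Section normal.
Hypothesis KP : forall x, K (P x).

Lemma speed_near (x : R) (c s : R) : 0 < c * cos (Phi x) + s * sin (Phi x) ->
  exists2 e : R, 0 < e & forall y : R, `|y - x| < e -> 0 < c * cos (Phi y) + s * sin (Phi y).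
Proof.
move=> h.
have dc := is_derive_mul (is_derive_const c x) (is_derive_compose (is_derive_cos _) (dPhi x)).
have ds := is_derive_mul (is_derive_const s x) (is_derive_compose (is_derive_sin _) (dPhi x)).
have /nbhs_ballP[e /= e0 he] := is_derive_continuous (is_derive_add dc ds) (lt_nbhsr h).
by exists e => // y yx; apply: he; rewrite /ball/= distrC.
Qed.

(** A direction along which the curve strictly advances at [x] separates the
    points slightly before from those slightly after [x]. *)
Lemma advance (x : R) (c s : R) : 0 < c * cos (Phi x) + s * sin (Phi x) ->
  exists2 e : R, 0 < e & forall d : R, 0 < d < e ->
    0 < c * (P (x + d) - P x).1 + s * (P (x + d) - P x).2 /\
    c * (P (x - d) - P x).1 + s * (P (x - d) - P x).2 < 0.
Proof.
move=> /speed_near[e e0 he]; exists e => // d /andP[d0 de]; split.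
  have xd : x < x + d by rewrite ltrDl.
  have [z /andP[z1 z2] ->] := chord_speed dP1 dP2 c s xd.
  rewrite mulr_gt0 ?subr_gt0// mulr_gt0// he// ltr_norml; apply/andP; split; lra.
have xd : x - d < x by rewrite gtrBl.
have [z /andP[z1 z2] E] := chord_speed dP1 dP2 c s xd.
rewrite (_ : _ + _ = - (c * (P x - P (x - d)).1 + s * (P x - P (x - d)).2)); last first.
  by rewrite /=; ring.
rewrite oppr_lt0 E mulr_gt0 ?subr_gt0// mulr_gt0// he// ltr_norml.
by apply/andP; split; lra.
Qed.

(** A normal cone direction is critical for the curve at the contact point, hence
    orthogonal to the tangent; a point strictly to the left of the tangent
    decides the sign. *)
Lemma outward_normal_curve (t : R) : (forall z, K z -> 0 <= det2 (T t) (z - P t)) ->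
  (exists2 z, K z & 0 < det2 (T t) (z - P t)) ->
  outward_normal K (P t) = (sin (Phi t), - cos (Phi t)).
Proof.
move=> inner [z0 Kz0 z0_gt0]; have cs := cos2Dsin2 (Phi t).
apply: get_unique.
  split; first by rewrite /enorm /dot/= -expr2 mulrNN -expr2 addrC cs sqrtr1.
  move=> z /inner; rewrite /det2 /dot/= => h; lra.
move=> u [u1 hu].
have uu : u.1 ^+ 2 + u.2 ^+ 2 = 1.
  rewrite -[RHS](expr1n _ 2) -u1 /enorm sqr_sqrtr /dot ?expr2//.
  by rewrite addr_ge0// -expr2 sqr_ge0.
have D0 : u.1 * cos (Phi t) + u.2 * sin (Phi t) = 0.
  have half (e : R) : 0 < e -> 0 < e / 2 < e.
    by move=> e0; apply/andP; split; lra.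
  have [D|D|//] := ltgtP (u.1 * cos (Phi t) + u.2 * sin (Phi t)) 0.
    have := @advance t (- u.1) (- u.2) _; rewrite !mulNr -opprD oppr_gt0.
    move=> /(_ D)[e /half eh /(_ _ eh)[_]].
    rewrite !mulNr -opprD oppr_lt0 => h.
    have := hu _ (KP (t - e / 2)); rewrite /dot leNgt => /negP; case.
    by rewrite mulrC [_ * u.2]mulrC.
  have [e /half eh /(_ _ eh)[h _]] := advance D.
  have := hu _ (KP (t + e / 2)); rewrite /dot leNgt => /negP; case.
  by rewrite mulrC [_ * u.2]mulrC.
pose e := u.1 * sin (Phi t) - u.2 * cos (Phi t).
have E1 : u.1 = e * sin (Phi t).
  transitivity (u.1 * (cos (Phi t) ^+ 2 + sin (Phi t) ^+ 2)); first by rewrite cs mulr1.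
  transitivity (e * sin (Phi t) + cos (Phi t) * (u.1 * cos (Phi t) + u.2 * sin (Phi t))).
    by rewrite /e; ring.
  by rewrite D0 mulr0 addr0.
have E2 : u.2 = - e * cos (Phi t).
  transitivity (u.2 * (cos (Phi t) ^+ 2 + sin (Phi t) ^+ 2)); first by rewrite cs mulr1.
  transitivity (- e * cos (Phi t) + sin (Phi t) * (u.1 * cos (Phi t) + u.2 * sin (Phi t))).
    by rewrite /e; ring.
  by rewrite D0 mulr0 addr0.
have : e ^+ 2 = 1.
  by rewrite -uu E1 E2 -[LHS]mulr1 -cs; ring.
move/eqP; rewrite sqrf_eq1 => /orP[|] /eqP e1.
  by rewrite [LHS]surjective_pairing E1 E2 e1 mul1r mulN1r.
have E : dot (z0 - P t) u = det2 (T t) (z0 - P t).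
  by rewrite /dot E1 E2 e1 /det2 /=; ring.
by have := hu _ Kz0; rewrite E leNgt z0_gt0.
Qed.

End normal.

Section boundary_curve.
Hypothesis cK : convex_set (K : set (convex_lmodType plane)).
Hypothesis KP : forall x, K (P x).
Hypothesis P_not_interior : forall x, ~ interior K (P x).
Hypothesis boundary_P : forall p, K p -> ~ interior K p -> exists x, P x = p.
Hypothesis K_interior : interior K !=set0.
Hypothesis k0 : forall x, 0 < k x.
Hypothesis P_per : forall x, P (x + 1) = P x.
Hypothesis P_inj : {in `[0, 1[ &, injective P}.

Let Phi_lt x y : x < y -> Phi x < Phi y.
Proof. exact: angle_increasing dPhi k0 _ _. Qed.

Lemma small_turn_near (x : R) : exists2 e : R, 0 < e &
  forall y z, x - e < y -> y < z -> z < x + e -> 0 < sin (Phi z - Phi y).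
Proof.
have p2 : 0 < (pi : R) / 2 by rewrite divr_gt0// pi_gt0.
have /nbhs_ballP[e /= e0 he] :=
  is_derive_continuous (dPhi x) (nbhsx_ballx (Phi x) (pi / 2) p2).
exists e => // y z xy yz zx; apply: sin_gt0_pi.
have hy : ball (Phi x) (pi / 2) (Phi y).
  by apply: he; rewrite /ball/= ltr_norml; apply/andP; split; lra.
have hz : ball (Phi x) (pi / 2) (Phi z).
  by apply: he; rewrite /ball/= ltr_norml; apply/andP; split; lra.
have := Phi_lt yz; move: hy hz; rewrite /ball/= !ltr_norml.
move=> /andP[y1 y2] /andP[z1 z2] h; apply/andP; split; first by lra.
by move: y1 y2 z1 z2; generalize (@pi R) => p *; lra.
Qed.

Lemma curve_above_tangent (x : R) : exists2 e : R, 0 < e &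
  forall d, 0 < d < e -> 0 < det2 (T x) (P (x + d) - P x).
Proof.
have [e e0 he] := small_turn_near x; exists e => // d /andP[d0 de].
have xd : x < x + d by rewrite ltrDl.
have [z /andP[z1 z2] E] := chord_speed dP1 dP2 (- sin (Phi x)) (cos (Phi x)) xd.
rewrite (_ : det2 _ _ = L * sin (Phi z - Phi x) * (x + d - x)); last first.
  by rewrite sinB /det2 /= -[LHS]addrC -mulNr E; ring.
by rewrite mulr_gt0 ?subr_gt0// mulr_gt0// he//; lra.
Qed.

(** The area spanned by the two chords is a double integral of the sine of the
    turning angle between a point before and a point after [x]; here the mean
    value theorem is used once for each chord. *)
Lemma chords_turn_left (x : R) : exists2 e : R, 0 < e &
  forall d, 0 < d < e -> 0 < det2 (P (x + d) - P x) (P (x - d) - P x).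
Proof.
have [e e0 he] := small_turn_near x; exists e => // d /andP[d0 de].
have xd : x < x + d by rewrite ltrDl.
have dx : x - d < x by rewrite gtrBl.
set A := P (x + d) - P x.
have [z /andP[z1 z2] Ez] := chord_speed dP1 dP2 (- A.2) A.1 dx.
have [w /andP[w1 w2] Ew] := chord_speed dP1 dP2 (- sin (Phi z)) (cos (Phi z)) xd.
rewrite (_ : det2 _ _ = L * (L * sin (Phi w - Phi z) * d) * d); last first.
  have -> : L * sin (Phi w - Phi z) * d = - sin (Phi z) * A.1 + cos (Phi z) * A.2.
    by rewrite /A Ew sinB; ring.
  have -> : det2 A (P (x - d) - P x) =
      - (- A.2 * (P x - P (x - d)).1 + A.1 * (P x - P (x - d)).2).
    by rewrite /det2 /=; ring.
  by rewrite Ez; ring.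
by rewrite !mulr_gt0// he//; lra.
Qed.

(** If some point of the body lay beyond the tangent line, that point together
    with two curve points just before and just after the contact point would
    span a triangle around the contact point, which is not interior. *)
Lemma body_left_of_tangent (x : R) z : K z -> 0 <= det2 (T x) (z - P x).
Proof.
move=> Kz; rewrite leNgt; apply/negP => neg.
set v := z - P x in neg.
have adv : 0 < - v.2 * cos (Phi x) + v.1 * sin (Phi x).
  by move: neg; rewrite /det2/=; lra.
have [e1 e10 h1] := advance adv.
have [e2 e20 h2] := chords_turn_left x.
pose d := Num.min e1 e2 / 2.
have m0 : 0 < Num.min e1 e2 by rewrite lt_min e10 e20.
have d1 : 0 < d < e1.
  have : Num.min e1 e2 <= e1 by rewrite ge_min lexx.
  by rewrite /d => ?; apply/andP; split; lra.
have d2 : 0 < d < e2.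
  have : Num.min e1 e2 <= e2 by rewrite ge_min lexx orbT.
  by rewrite /d => ?; apply/andP; split; lra.
have [f1 f2] := h1 _ d1.
apply: (@P_not_interior x).
apply: (interior_triangle cK Kz (KP (x + d)) (KP (x - d))).
- by move: f1; rewrite -/v /det2; lra.
- exact: h2.
- by move: f2; rewrite -/v /det2; lra.
Qed.

(** An interior point on the tangent line could be moved across that line
    inside the body. *)
Lemma interior_left_of_tangent (x : R) p : interior K p -> 0 < det2 (T x) (p - P x).
Proof.
move=> Kp; rewrite lt_neqAle body_left_of_tangent ?andbT; last exact: interior_subset.
apply/eqP => E.
have /nbhs_ballP[e /= e0 he] := Kp.
pose q : plane := (p.1 + e / 2 * sin (Phi x), p.2 - e / 2 * cos (Phi x)).
have Kq : K q.
  apply: he; split; rewrite /ball/=.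
    rewrite opprD addrA subrr sub0r normrN normrM gtr0_norm ?divr_gt0//.
    by have := sin_max (Phi x); nra.
  rewrite opprB addrC subrK normrM gtr0_norm ?divr_gt0//.
  by have := cos_max (Phi x); nra.
have := @body_left_of_tangent x q Kq.
have -> : det2 (T x) (q - P x) = det2 (T x) (p - P x) -
    e / 2 * (cos (Phi x) ^+ 2 + sin (Phi x) ^+ 2).
  by rewrite /det2 /=; ring.
by rewrite -E cos2Dsin2; lra.
Qed.

(** The curve cannot touch the relative interior of a segment of the body along
    its tangent: it would then enter the triangle over that segment. *)
Lemma no_tangent_segment (x mu : R) : 0 < mu ->
  K (P x - mu *: T x) -> K (P x + mu *: T x) -> False.
Proof.
set a := P x - _; set b := P x + _ => mu0 Ka Kb.
have [q Kq] := K_interior.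
have qx : 0 < det2 (T x) (q - P x) by exact: interior_left_of_tangent.
have Pc1 : {for x, continuous (fun y => (P y).1)} := is_derive_continuous (dP1 x).
have Pc2 : {for x, continuous (fun y => (P y).2)} := is_derive_continuous (dP2 x).
have det_near (u w : plane) : 0 < det2 (u - P x) (w - P x) ->
    \forall y \near x, 0 < det2 (u - P y) (w - P y).
  move=> h.
  have dc : {for x, continuous (fun y => det2 (u - P y) (w - P y))}.
    rewrite /det2 /=; apply: cvgB; apply: cvgM; apply: cvgB;
      by [exact: cvg_cst|exact: Pc1|exact: Pc2].
  exact: (dc _ (lt_nbhsr h)).
have h1 : 0 < det2 (b - P x) (q - P x).
  rewrite (_ : det2 _ _ = mu * det2 (T x) (q - P x)) ?mulr_gt0//.
  by rewrite /b /det2 /= /GRing.scale /=; ring.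
have h2 : 0 < det2 (q - P x) (a - P x).
  rewrite (_ : det2 _ _ = mu * det2 (T x) (q - P x)) ?mulr_gt0//.
  by rewrite /a /det2 /= /GRing.scale /=; ring.
have /nbhs_ballP[e1 /= e10 he1] : \forall y \near x,
    0 < det2 (b - P y) (q - P y) /\ 0 < det2 (q - P y) (a - P y).
  by have := det_near _ _ h1; have := det_near _ _ h2; apply: filterS2.
have [e2 e20 he2] := curve_above_tangent x.
pose d := Num.min e1 e2 / 2.
have m0 : 0 < Num.min e1 e2 by rewrite lt_min e10 e20.
have d2 : 0 < d < e2.
  have : Num.min e1 e2 <= e2 by rewrite ge_min lexx orbT.
  by rewrite /d => ?; apply/andP; split; lra.
have [g1 g2] : 0 < det2 (b - P (x + d)) (q - P (x + d)) /\
    0 < det2 (q - P (x + d)) (a - P (x + d)).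
  apply: he1; rewrite /ball/= opprD addrA subrr sub0r normrN.
  have : Num.min e1 e2 <= e1 by rewrite ge_min lexx.
  by move=> ?; rewrite gtr0_norm /d; lra.
apply: (@P_not_interior (x + d)).
apply: (interior_triangle cK Ka Kb (interior_subset Kq)) => //.
rewrite (_ : det2 _ _ = 2 * mu * det2 (T x) (P (x + d) - P x)).
  by rewrite !mulr_gt0// he2.
by rewrite /a /b /det2 /= /GRing.scale /=; ring.
Qed.

Lemma curve_neq (s v : R) : 0 < v < 1 -> P (s + v) <> P s.
Proof.
move=> /andP[v0 v1] E.
have per_int := curve_per_int P_per.
pose s' := s - (Num.floor s)%:~R.
have /andP[s0 s1] : 0 <= s' < 1.
  by rewrite /s' subr_ge0 floor_le ltrBlDl -intrD1 lt_succ_floor.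
have Ps' : P s' = P s by rewrite -[RHS](per_int (- Num.floor s)) mulrNz.
have Psv : P (s' + v) = P s.
  by rewrite -E -[RHS](per_int (- Num.floor s)) mulrNz addrAC.
have [h|h] := ltP (s' + v) 1.
  have := P_inj (x := s' + v) (y := s'); rewrite !in_itv/= h s0 s1 Ps' Psv.
  have -> : 0 <= s' + v by lra.
  by move=> /(_ isT isT erefl); lra.
have := P_inj (x := s' + v - 1) (y := s'); rewrite !in_itv/= s0 s1 Ps'.
rewrite -(P_per (s' + v - 1)) subrK Psv subr_ge0 h.
have -> : s' + v - 1 < 1 by lra.
by move=> /(_ isT isT erefl); lra.
Qed.

Lemma tangent_dist_ge0_convex s t : 0 <= tangent_dist P Phi s t.
Proof. exact: body_left_of_tangent. Qed.

(** A chord lying on the tangent line would consist of boundary points, so that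
    its midpoint is on the curve, with the chord as its tangent:
    [no_tangent_segment] excludes this. *)
Lemma tangent_dist_gt0_convex (s v : R) : 0 < v < 1 -> 0 < tangent_dist P Phi s (s + v).
Proof.
move=> v01; rewrite lt_neqAle tangent_dist_ge0_convex andbT; apply/eqP => E.
set t := s + v in E.
pose m : plane := ((1 * (P s).1 + 1 * (P t).1) / (1 + 1), (1 * (P s).2 + 1 * (P t).2) / (1 + 1)).
have Km : K m by apply: (convex_combination cK).
have m1 : m.1 = ((P s).1 + (P t).1) / 2 by rewrite /m/=; field.
have m2 : m.2 = ((P s).2 + (P t).2) / 2 by rewrite /m/=; field.
have mI : ~ interior K m.
  move=> /(interior_left_of_tangent s).
  have -> : det2 (T s) (m - P s) = tangent_dist P Phi s t / 2.
    by rewrite /tangent_dist /m /det2/=; field.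
  by rewrite -E mul0r ltxx.
have [tau mE] := boundary_P Km mI.
have ds := @body_left_of_tangent tau _ (KP s).
have dt := @body_left_of_tangent tau _ (KP t).
have d0 : cos (Phi tau) * (P t - P s).2 - sin (Phi tau) * (P t - P s).1 = 0.
  have : det2 (T tau) (P s - P tau) + det2 (T tau) (P t - P tau) = 0.
    by rewrite mE /m /det2/=; field.
  move=> sum0; have ds0 : det2 (T tau) (P s - P tau) = 0 by lra.
  transitivity (det2 (T tau) (P t - P tau) - det2 (T tau) (P s - P tau)); last by lra.
  by rewrite /det2 /=; ring.
pose lam := cos (Phi tau) * (P t - P s).1 + sin (Phi tau) * (P t - P s).2.
have cs := cos2Dsin2 (Phi tau).
have c1 : (P t - P s).1 = lam * cos (Phi tau).
  transitivity ((P t - P s).1 * (cos (Phi tau) ^+ 2 + sin (Phi tau) ^+ 2)).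
    by rewrite cs mulr1.
  transitivity (lam * cos (Phi tau) - sin (Phi tau) *
    (cos (Phi tau) * (P t - P s).2 - sin (Phi tau) * (P t - P s).1)).
    by rewrite /lam; ring.
  by rewrite d0 mulr0 subr0.
have c2 : (P t - P s).2 = lam * sin (Phi tau).
  transitivity ((P t - P s).2 * (cos (Phi tau) ^+ 2 + sin (Phi tau) ^+ 2)).
    by rewrite cs mulr1.
  transitivity (lam * sin (Phi tau) + cos (Phi tau) *
    (cos (Phi tau) * (P t - P s).2 - sin (Phi tau) * (P t - P s).1)).
    by rewrite /lam; ring.
  by rewrite d0 mulr0 addr0.
have {}c1 : (P t).1 - (P s).1 = lam * cos (Phi tau) by [].
have {}c2 : (P t).2 - (P s).2 = lam * sin (Phi tau) by [].
clearbody lam.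
have ends : P tau - (lam / 2) *: T tau = P s /\ P tau + (lam / 2) *: T tau = P t.
  split.
    rewrite mE [RHS]surjective_pairing; congr (_, _).
      change (m.1 - lam / 2 * cos (Phi tau) = (P s).1); rewrite m1; lra.
    change (m.2 - lam / 2 * sin (Phi tau) = (P s).2); rewrite m2; lra.
  rewrite mE [RHS]surjective_pairing; congr (_, _).
    change (m.1 + lam / 2 * cos (Phi tau) = (P t).1); rewrite m1; lra.
  change (m.2 + lam / 2 * sin (Phi tau) = (P t).2); rewrite m2; lra.
have [e1 e2] := ends.
have [lam0|lam0|lam0] := ltgtP lam 0.
- apply: (@no_tangent_segment tau (- (lam / 2))); first by lra.
    by rewrite scaleNr opprK e2.
  by rewrite scaleNr e1.
- apply: (@no_tangent_segment tau (lam / 2)); first by lra.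
    by rewrite e1.
  by rewrite e2.
- apply: (curve_neq v01 (s := s)); rewrite -/t -e1 -e2 lam0 mul0r !scale0r.
  by rewrite addr0 subr0.
Qed.

Let is_derive_unique (f : R -> R) (x a b : R) :
  is_derive x 1 f a -> is_derive x 1 f b -> a = b.
Proof. by move=> [_ <-] [_ <-]. Qed.

Let T_per x : cos (Phi (x + 1)) = cos (Phi x) /\ sin (Phi (x + 1)) = sin (Phi x).
Proof.
have Ln0 : L != 0 by rewrite gt_eqF.
have d1 := is_derive_shift (dP1 (x + 1)); have d2 := is_derive_shift (dP2 (x + 1)).
have E1 : (fun y => (P (y + 1)).1) = (fun y => (P y).1).
  by apply/funext => y; rewrite P_per.
have E2 : (fun y => (P (y + 1)).2) = (fun y => (P y).2).
  by apply/funext => y; rewrite P_per.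
rewrite E1 in d1; rewrite E2 in d2.
split; apply: (mulfI Ln0); first exact: is_derive_unique d1 (dP1 x).
exact: is_derive_unique d2 (dP2 x).
Qed.

(** The tangent vectors are periodic, and the turning rate is determined by
    them. *)
Let kc_per x : k (x + 1) = k x.
Proof.
have dc y := is_derive_compose (is_derive_cos _) (dPhi y).
have ds y := is_derive_compose (is_derive_sin _) (dPhi y).
have dc1 := is_derive_shift (dc (x + 1)); have ds1 := is_derive_shift (ds (x + 1)).
have Ec : (fun y => cos (Phi (y + 1))) = (fun y => cos (Phi y)).
  by apply/funext => y; exact: (T_per y).1.
have Es : (fun y => sin (Phi (y + 1))) = (fun y => sin (Phi y)).
  by apply/funext => y; exact: (T_per y).2.
rewrite Ec in dc1; rewrite Es in ds1.
have e1 := is_derive_unique dc1 (dc x); have e2 := is_derive_unique ds1 (ds x).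
rewrite !(T_per x).1 !(T_per x).2 in e1 e2.
transitivity ((cos (Phi x) ^+ 2 + sin (Phi x) ^+ 2) * k (x + 1)).
  by rewrite cos2Dsin2 mul1r.
transitivity (cos (Phi x) * (cos (Phi x) * k (x + 1)) -
              sin (Phi x) * (- sin (Phi x) * k (x + 1))); first by ring.
rewrite e1 e2; transitivity ((cos (Phi x) ^+ 2 + sin (Phi x) ^+ 2) * k x); first by ring.
by rewrite cos2Dsin2 mul1r.
Qed.

(** A second full turn within one period would produce two distinct points with
    the same oriented tangent, each strictly to the left of the other one's
    tangent line. *)
Lemma total_turning (x : R) : Phi (x + 1) = Phi x + 2 * pi.
Proof.
pose tau := Phi 1 - Phi 0.
have dD (y : R) : is_derive y 1 (fun y => Phi (y + 1) - Phi y) 0.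
  apply: (is_derive_eq (is_derive_sub (is_derive_shift (dPhi (y + 1))) (dPhi y))).
  by rewrite kc_per subrr.
have := is_derive0_const dD x 0; rewrite add0r -/tau => E.
suff : tau = 2 * pi by lra.
have tau0 : 0 < tau by rewrite subr_gt0 Phi_lt.
have ctau : cos tau = 1.
  have [] := T_per 0; rewrite add0r => c s.
  by rewrite /tau cosB c s -!expr2 cos2Dsin2.
have [lt|gt|//] := ltgtP tau (2 * pi).
  have st : 0 < sin (tau / 2).
    by apply: sin_gt0_pi; move: tau0 lt; generalize (@pi R) => *; apply/andP; split; lra.
  have : cos (tau / 2 *+ 2) = 1 by rewrite -mulr_natr divfK.
  rewrite cos_mulr2n -mulr_natl; have := cos2Dsin2 (tau / 2); nra.
have [t /[!in_itv]/= /andP[t0 t1] tE] : exists2 t, t \in `[0, 1] & Phi t = Phi 0 + 2 * pi.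
  apply: IVT => //.
    apply: continuous_subspaceT => y; exact: is_derive_continuous (dPhi y).
  have /ltW h : Phi 0 < Phi 1 by apply: Phi_lt.
  rewrite (min_idPl h) (max_idPr h).
  have := pi_gt0 R; move: gt; rewrite /tau; generalize (@pi R) => p *.
  by apply/andP; split; lra.
have pi0 := pi_gt0 R.
have t0' : 0 < t.
  rewrite lt_neqAle t0 andbT; apply/eqP => t0E.
  by move: tE pi0; rewrite -t0E; generalize (@pi R) => *; lra.
have t1' : t < 1.
  rewrite lt_neqAle t1 andbT; apply/eqP => t1E.
  by move: tE gt; rewrite t1E /tau; generalize (@pi R) => *; lra.
have h1 := @tangent_dist_gt0_convex 0 t; have h2 := @tangent_dist_gt0_convex t (1 - t).
have {}h1 : 0 < tangent_dist P Phi 0 t by rewrite add0r in h1; apply: h1; rewrite t0'.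
have {}h2 : 0 < tangent_dist P Phi t 1.
  by rewrite addrCA subrr addr0 in h2; apply: h2; apply/andP; split; lra.
have P10 : P 1 = P 0 by rewrite -[1]add0r P_per.
move: h1 h2; rewrite /tangent_dist tE mulr_natl cosD2pi sinD2pi P10 /det2/=; lra.
Qed.

Lemma outward_normal_convex (t : R) :
  outward_normal K (P t) = (sin (Phi t), - cos (Phi t)).
Proof.
apply: (outward_normal_curve KP); first exact: body_left_of_tangent.
exists (P (t + 2^-1)); first exact: KP.
apply: tangent_dist_gt0_convex.
by apply/andP; split; lra.
Qed.

End boundary_curve.
End geometry.

Section C2plus.
Context {R : realType}.
Local Notation plane := (R * R)%type.

Lemma is_derive_fst (f : R -> plane) (t : R) : derivable f t 1 ->
  is_derive t 1 (fun y => (f y).1) (derive1 f t).1.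
Proof.
move=> df; rewrite derive1E.
have h : (h^-1 *: ((f (h *: (1 : R) + t)).1 - (f t).1) : R) @[h --> 0^'] --> ('D_1 f t).1.
  exact: (cvg_comp _ _ df cvg_fst).
split; first exact: (cvgP _ h).
exact: cvg_lim.
Qed.

Lemma is_derive_snd (f : R -> plane) (t : R) : derivable f t 1 ->
  is_derive t 1 (fun y => (f y).2) (derive1 f t).2.
Proof.
move=> df; rewrite derive1E.
have h : (h^-1 *: ((f (h *: (1 : R) + t)).2 - (f t).2) : R) @[h --> 0^'] --> ('D_1 f t).2.
  exact: (cvg_comp _ _ df cvg_snd).
split; first exact: (cvgP _ h).
exact: cvg_lim.
Qed.

(** The boundary of the body, run through at constant speed once per unit of
    parameter, together with its tangent angle [Phi]. *)
Lemma C2plus_parametrization (K : set plane) : C2plus K ->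
  exists P : R -> plane, exists Phi k : R -> R, exists L : R,
  [/\ 0 < L /\ range P = boundary K,
      forall x : R, is_derive x 1 (fun y => (P y).1) (L * cos (Phi x)),
      forall x : R, is_derive x 1 (fun y => (P y).2) (L * sin (Phi x)),
      forall x : R, is_derive x 1 Phi (k x) &
      [/\ forall x, 0 < k x, continuous k, forall x, P (x + 1) = P x &
          {in `[0, 1[ &, injective P}]].
Proof.
move=> [_ [g [L [[L0 g_per g_inj] rg [dg dV cA] arc [_ curv]]]]].
have half_zero (a1 a2 w1 w2 : R) : 0 = a1 * w1 + w1 * a1 + (a2 * w2 + w2 * a2) ->
    w1 * a1 + w2 * a2 = 0.
  by move: a1 a2 w1 w2; clear => a1 a2 w1 w2; lra.
pose V := derive1 g; pose A := derive1n 2 g.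
have V1 t : (V t).1 * (V t).1 + (V t).2 * (V t).2 = 1.
  have := arc t; rewrite /enorm => h.
  rewrite -[RHS](expr1n _ 2) -h sqr_sqrtr// /dot addr_ge0// -expr2 sqr_ge0//.
have dg1 t := is_derive_fst (dg t); have dg2 t := is_derive_snd (dg t).
have dV1 (t : R) : is_derive t 1 (fun y => (V y).1) (A t).1 := is_derive_fst (dV t).
have dV2 (t : R) : is_derive t 1 (fun y => (V y).2) (A t).2 := is_derive_snd (dV t).
have VA t : (V t).1 * (A t).1 + (V t).2 * (A t).2 = 0.
  have d := is_derive_add (is_derive_mul (dV1 t) (dV1 t)) (is_derive_mul (dV2 t) (dV2 t)).
  have e : (fun y => (V y).1 * (V y).1 + (V y).2 * (V y).2) = fun=> 1 by apply/funext.
  have [_ v1] := d; have [_ v2] := is_derive_const 1 t.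
  rewrite e v2 in v1.
  have : (0 : R) = (A t).1 * (V t).1 + (V t).1 * (A t).1 +
    ((A t).2 * (V t).2 + (V t).2 * (A t).2) := v1.
  exact: half_zero.
have dL (x : R) : is_derive x 1 (fun y : R => L * y) L.
  apply: (is_derive_eq (is_derive_mul (is_derive_const L x) (is_derive_ident x))).
  by rewrite mul0r add0r mulr1.
pose k x := L * signed_curvature g (L * x).
have kc : continuous k.
  have cV1 t := is_derive_continuous (dV1 t); have cV2 t := is_derive_continuous (dV2 t).
  have cA1 := continuous_fst_comp cA; have cA2 := continuous_snd_comp cA.
  have cL (x : R) := is_derive_continuous (dL x).
  have cc : continuous (signed_curvature g).
    move=> t; rewrite /signed_curvature /det2; apply: cvgB; apply: cvgM.
    + exact: cV1.
    + exact: cA2.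
    + exact: cV2.
    + exact: cA1.
  move=> x; apply: cvgM; first exact: cvg_cst.
  by apply: continuous_comp; [exact: cL|exact: cc].
pose T1 x := (V (L * x)).1; pose T2 x := (V (L * x)).2.
have dT1 (x : R) : is_derive x 1 T1 (- (k x * T2 x)).
  apply: (is_derive_eq (is_derive_compose (dV1 _) (dL x))).
  have -> : k x = L * ((V (L * x)).1 * (A (L * x)).2 - (V (L * x)).2 * (A (L * x)).1) by [].
  rewrite /T2.
  have := V1 (L * x); have := VA (L * x); move: (V (L * x)) (A (L * x)) => [v1 v2] [a1 a2] /= e0 e1.
  transitivity (a1 * L * (v1 * v1 + v2 * v2)); first by rewrite e1 mulr1.
  transitivity (- (L * (v1 * a2 - v2 * a1) * v2) + L * v1 * (v1 * a1 + v2 * a2)); first by ring.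
  by rewrite e0 mulr0 addr0.
have dT2 (x : R) : is_derive x 1 T2 (k x * T1 x).
  apply: (is_derive_eq (is_derive_compose (dV2 _) (dL x))).
  have -> : k x = L * ((V (L * x)).1 * (A (L * x)).2 - (V (L * x)).2 * (A (L * x)).1) by [].
  rewrite /T1.
  have := V1 (L * x); have := VA (L * x); move: (V (L * x)) (A (L * x)) => [v1 v2] [a1 a2] /= e0 e1.
  transitivity (a2 * L * (v1 * v1 + v2 * v2)); first by rewrite e1 mulr1.
  transitivity (L * (v1 * a2 - v2 * a1) * v1 + L * v2 * (v1 * a1 + v2 * a2)); first by ring.
  by rewrite e0 mulr0 addr0.
have T12 x : T1 x ^+ 2 + T2 x ^+ 2 = 1 by rewrite !expr2 V1.
have [Phi dPhi T_Phi] := angle_lift kc dT1 dT2 T12.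
exists (fun x => g (L * x)), Phi, k, L; split.
- split => //; rewrite -rg; apply/seteqP; split => [_ [x _ <-]|_ [x _ <-]].
    by exists (L * x).
  by exists (x / L) => //; rewrite mulrC divfK// gt_eqF.
- move=> x; apply: (is_derive_eq (is_derive_compose (dg1 _) (dL x))).
  by rewrite mulrC -(T_Phi x).1.
- move=> x; apply: (is_derive_eq (is_derive_compose (dg2 _) (dL x))).
  by rewrite mulrC -(T_Phi x).2.
- exact: dPhi.
- split => //.
  + by move=> x; rewrite mulr_gt0.
  + by move=> x; rewrite mulrDr mulr1 g_per.
  + move=> x y; rewrite !in_itv/= => /andP[x0 x1] /andP[y0 y1] E.
    have Ln0 : L != 0 by rewrite gt_eqF.
    apply: (mulfI Ln0); apply: g_inj => //; rewrite in_itv/=.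
      by rewrite (mulr_ge0 (ltW L0) x0) gtr_pMr.
    by rewrite (mulr_ge0 (ltW L0) y0) gtr_pMr.
Qed.

End C2plus.

(** * The unit disk *)

Section disk.
Context {R : realType}.
Local Notation plane := (R * R)%type.
Local Notation leb := (@lebesgue_measure R).
Local Notation K := (closure (unit_disk R)).

Lemma enormZ (c : R) (p : plane) : 0 <= c -> enorm (c * p.1, c * p.2) = c * enorm p.
Proof.
move=> c0; rewrite /enorm /dot/=.
rewrite (_ : _ + _ = c ^+ 2 * (p.1 * p.1 + p.2 * p.2)); last by ring.
by rewrite sqrtrM ?sqr_ge0// sqrtr_sqr ger0_norm.
Qed.

Lemma coord_le_enorm (p : plane) : `|p.1| <= enorm p /\ `|p.2| <= enorm p.
Proof.
have pp : 0 <= p.1 * p.1 + p.2 * p.2 by rewrite addr_ge0// -expr2 sqr_ge0.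
by split; rewrite -sqrtr_sqr /enorm ler_sqrt// /dot -!expr2 ?lerDl ?lerDr sqr_ge0.
Qed.

Lemma closure_unit_disk : K = [set p | enorm p <= 1].
Proof.
have ce : continuous (fun q : plane => enorm q).
  by apply: (@continuous_enorm R plane id) => q; exact: cvg_id.
apply/seteqP; split.
  have cl : closed [set p : plane | enorm p <= 1].
    apply: (@preimage_closed _ _ (fun q : plane => enorm q) [set x | x <= 1]).
      by move=> q _; exact: ce.
    exact: closed_le.
  rewrite [X in _ `<=` X](closure_id _).1//.
  by apply: closure_subset => q /ltW.
move=> p /= p1 B /nbhs_ballP[e /= e0 eB].
pose c := Num.min (2^-1) (e / 2).
have c0 : 0 < c by rewrite lt_min invr_gt0 ltr0n divr_gt0.
have c2 : c <= 2^-1 by rewrite ge_min lexx.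
have ce2 : c <= e / 2 by rewrite ge_min lexx orbT.
have [n1 n2] := coord_le_enorm p.
exists ((1 - c) * p.1, (1 - c) * p.2); split.
  rewrite /unit_disk /= enormZ; last by lra.
  by have := enorm_ge0 p; nra.
apply: eB; split; rewrite /ball/= mulrBl mul1r opprB addrC subrK normrM gtr0_norm//; nra.
Qed.

Lemma boundary_disk : boundary K = [set p | enorm p = 1].
Proof.
have ce : continuous (fun q : plane => enorm q).
  by apply: (@continuous_enorm R plane id) => q; exact: cvg_id.
rewrite /boundary (_ : closure K = K); last by rewrite -(closure_id _).1//; exact: closed_closure.
rewrite closure_unit_disk; apply/seteqP; split => p /=.
  move=> [p1 pI]; apply/eqP; rewrite eq_le p1/= leNgt; apply/negP => lt1; apply: pI.
  have : \forall q \near p, enorm q < 1 by exact: (ce p _ (lt_nbhsl lt1)).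
  by apply: filterS => q /ltW.
move=> p1; split; first by rewrite p1.
move=> /nbhs_ballP[e /= e0 eB].
have [n1 n2] := coord_le_enorm p; rewrite p1 in n1 n2.
have : [set p : plane | enorm p <= 1] ((1 + e / 2) * p.1, (1 + e / 2) * p.2).
  apply: eB; split; rewrite /ball/= mulrDl mul1r opprD addrA subrr sub0r normrN
    normrM gtr0_norm ?divr_gt0//; nra.
by rewrite /= enormZ ?p1; lra.
Qed.

Let P (x : R) : plane := (cos (2 * pi * x), sin (2 * pi * x)).
Let Phi (x : R) : R := 2 * pi * x + pi / 2.

Let cosPhi x : cos (Phi x) = - sin (2 * pi * x).
Proof. by rewrite /Phi cosDpihalf. Qed.

Let sinPhi x : sin (Phi x) = cos (2 * pi * x).
Proof. by rewrite /Phi sinDpihalf. Qed.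

Let d_lin (c x : R) : is_derive x 1 (fun y : R => c * y) c.
Proof.
apply: (is_derive_eq (is_derive_mul (is_derive_const c x) (is_derive_ident x))).
by rewrite mul0r add0r mulr1.
Qed.

Let dP1 (x : R) : is_derive x 1 (fun y => (P y).1) (2 * pi * cos (Phi x)).
Proof.
apply: (is_derive_eq (is_derive_compose (is_derive_cos _) (d_lin (2 * pi) x))).
by rewrite cosPhi mulrC.
Qed.

Let dP2 (x : R) : is_derive x 1 (fun y => (P y).2) (2 * pi * sin (Phi x)).
Proof.
apply: (is_derive_eq (is_derive_compose (is_derive_sin _) (d_lin (2 * pi) x))).
by rewrite sinPhi mulrC.
Qed.

Let dPhi (x : R) : is_derive x 1 Phi (2 * pi).
Proof.
by apply: (is_derive_eq (is_derive_add (d_lin (2 * pi) x) (is_derive_const (pi / 2) x))); rewrite addr0.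
Qed.

Let P_per x : P (x + 1) = P x.
Proof. by rewrite /P mulrDr mulr1 mulr_natl cosD2pi sinD2pi. Qed.

Let tangent_distE s t : tangent_dist P Phi s t = 2 * sin (pi * (t - s)) ^+ 2.
Proof.
have -> : tangent_dist P Phi s t = 1 - cos (2 * pi * t - 2 * pi * s).
  rewrite /tangent_dist cosPhi sinPhi /det2 /P /= cosB.
  by have := cos2Dsin2 (2 * pi * s); lra.
rewrite -mulrBr (_ : 2 * pi * (t - s) = (pi * (t - s)) *+ 2); last first.
  by rewrite -mulrA mulr_natl.
by rewrite cos_mulr2n; have := cos2Dsin2 (pi * (t - s)); lra.
Qed.

Let tangent_dist_ge0 s t : 0 <= tangent_dist P Phi s t.
Proof. by rewrite tangent_distE mulr_ge0// sqr_ge0. Qed.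

Let tangent_dist_gt0 (s v : R) : 0 < v < 1 -> 0 < tangent_dist P Phi s (s + v).
Proof.
move=> /andP[v0 v1]; rewrite tangent_distE addrAC subrr add0r.
by rewrite mulr_gt0// exprn_gt0// sin_gt0_pi// mulr_gt0 ?pi_gt0//= gtr_pMr ?pi_gt0.
Qed.

Let enormP x : enorm (P x) = 1.
Proof. by rewrite /enorm /dot/= -!expr2 cos2Dsin2 sqrtr1. Qed.

Let rangeP : range P = boundary K.
Proof.
rewrite boundary_disk; apply/seteqP; split => [_ [x _ <-]|p /= p1]; first exact: enormP.
have pp : p.1 ^+ 2 + p.2 ^+ 2 = 1.
  rewrite -[RHS](expr1n _ 2) -p1 /enorm sqr_sqrtr /dot ?expr2//.
  by rewrite addr_ge0// -expr2 sqr_ge0.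
have [th c s] : exists2 th, p.1 = cos th & p.2 = sin th.
  have T10 : -1 <= p.1 <= 1.
    rewrite -ler_norml -(@expr_le1 _ 2) ?normr_ge0//.
    by rewrite real_normK ?num_real// -pp lerDl sqr_ge0.
  have [_ cE] := acos_def T10.
  have : sin (acos p.1) ^+ 2 = p.2 ^+ 2.
    by have := cos2Dsin2 (acos p.1); rewrite cE; lra.
  move/eqP; rewrite eqf_sqr => /orP[|] /eqP E.
    by exists (acos p.1).
  by exists (- acos p.1); rewrite ?cosN ?sinN ?cE ?E ?opprK.
exists (th / (2 * pi)) => //; rewrite /P.
have p0 : (2 * pi : R) != 0 by rewrite mulf_neq0// gt_eqF// pi_gt0.
by rewrite mulrC divfK// -c -s -surjective_pairing.
Qed.

Let KP x : K (P x).
Proof. by rewrite closure_unit_disk /= enormP. Qed.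

Let normalE t : outward_normal K (P t) = (sin (Phi t), - cos (Phi t)).
Proof.
apply: (outward_normal_curve _ dP1 dP2 dPhi KP) => [|z|].
- by rewrite mulr_gt0 ?pi_gt0.
- rewrite closure_unit_disk /= => z1.
  have := @proj_le_enorm R z (cos (2 * pi * t)) (sin (2 * pi * t)) (cos2Dsin2 _).
  move=> /(le_trans (ler_norm _)) h.
  rewrite (_ : det2 _ _ = 1 - (cos (2 * pi * t) * z.1 + sin (2 * pi * t) * z.2)).
    by lra.
  by rewrite cosPhi sinPhi /det2 /=; have := cos2Dsin2 (2 * pi * t); lra.
- exists 0.
    by rewrite closure_unit_disk /= /enorm /dot/= mul0r addr0 sqrtr0.
  rewrite (_ : det2 _ _ = cos (2 * pi * t) ^+ 2 + sin (2 * pi * t) ^+ 2).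
    by rewrite cos2Dsin2.
  by rewrite cosPhi sinPhi /det2 /=; ring.
Qed.

Lemma Per_disk : Per K = (2 * pi)%:E.
Proof.
apply: (Per_curve _ dP1 dP2 dPhi _ _ P_per tangent_dist_gt0 rangeP).
- by rewrite mulr_gt0 ?pi_gt0.
- by move=> _; rewrite mulr_gt0 ?pi_gt0.
- by move=> x; exact: cvg_cst.
Qed.

Let chordE s t : enorm (P s - P t) = 2 * `|sin (pi * (t - s))|.
Proof.
have -> : enorm (P s - P t) = Num.sqrt (2 * tangent_dist P Phi t s).
  rewrite /enorm; congr Num.sqrt; rewrite /tangent_dist cosPhi sinPhi /dot /det2 /P /=.
  by have := cos2Dsin2 (2 * pi * s); have := cos2Dsin2 (2 * pi * t); lra.
rewrite tangent_distE -opprB mulrN sinN sqrrN.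
rewrite (_ : 2 * _ = (2 * sin (pi * (t - s))) ^+ 2); last by ring.
by rewrite sqrtr_sqr normrM ger0_norm.
Qed.

Let kernelE alpha s t : 0 < alpha -> wkernel P Phi alpha s t =
  2^-1 * 2 `^ (- alpha) * `|sin (pi * (t - s))| `^ (- alpha).
Proof.
move=> al0; rewrite /wkernel chordE tangent_distE -opprB mulrN sinN sqrrN.
rewrite -[_ ^+ 2]real_normK ?num_real//.
have [S0|S0] := eqVneq (sin (pi * (t - s))) 0.
  by rewrite S0 normr0 expr2 !mulr0 mul0r powR0 ?mulr0// oppr_eq0 gt_eqF.
have {}S0 : 0 < `|sin (pi * (t - s))| by rewrite normr_gt0.
set S := `|_| in S0 *.
have S2 : 0 < 2 * S by rewrite mulr_gt0.
rewrite powRD; last by apply/implyP => _; rewrite gt_eqF.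
rewrite (_ : (2 * S) `^ 2 = (2 * S) ^+ 2); last by rewrite powR_mulrn// ltW.
rewrite powRM ?ltW// !powRN; field.
by rewrite !gt_eqF ?powR_gt0.
Qed.

Lemma W_disk alpha : 0 < alpha ->
  W alpha K = ((2 * pi * (2 * pi) * (2^-1 * 2 `^ (- alpha)))%:E * circle_energy alpha)%E.
Proof.
move=> al0; set c := 2^-1 * 2 `^ (- alpha).
have c0 : 0 <= c by rewrite /c mulr_ge0// powR_ge0.
have L0 : 0 < 2 * pi :> R by rewrite mulr_gt0 ?pi_gt0.
rewrite (W_curve L0 dP1 dP2 dPhi (fun=> L0) (fun x => cvg_cst (2 * pi)) P_per
  tangent_dist_ge0 tangent_dist_gt0 rangeP alpha normalE).
rewrite [in RHS]EFinM -muleA; congr (_ * _)%E.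
have Phi_per x : Phi (x + 1) = Phi x + 2 * pi.
  by rewrite /Phi mulrDr mulr1 addrAC.
have mI : measurable (`[0, 1[%classic : set R) by exact: measurable_itv.
transitivity (\int[leb]_(s in `[0%R, 1%R[) (c%:E * circle_energy alpha))%E; last first.
  rewrite integral_cst//.
  have leb01 : leb (`[0%R, 1%R[%classic : set R) = 1%E.
    by rewrite lebesgue_measure_itv/= lte_fin ltr01 sube0.
  by rewrite -[RHS]mule1; congr (_ * _)%E; exact: leb01.
apply: eq_integral => s; rewrite inE/= in_itv/= => s01.
have mw : measurable_fun setT (fun t => (wkernel P Phi alpha s t)%:E).
  apply/measurable_EFinP.
  exact: (measurable_fun_pair2 s (measurable_wkernel dP1 dP2 dPhi alpha)).
have w0 t : (0 <= (wkernel P Phi alpha s t)%:E)%E.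
  by rewrite lee_fin; exact: wkernel_ge0.
have wper t : ((wkernel P Phi alpha s (t + 1))%:E = (wkernel P Phi alpha s t)%:E)%E.
  by rewrite (wkernel_per P_per Phi_per alpha s t).2.
rewrite (ge0_integral_period s01 mw w0 wper) /circle_energy -ge0_integralZl//.
- apply: eq_integral => v; rewrite inE/= => v01.
  by rewrite kernelE// addrK ger0_norm ?sin_pi_ge0// EFinM.
- apply/measurable_EFinP.
  exact: (measurable_funS measurableT (@subsetT _ _) (measurable_sin_powR alpha)).
- by move=> v _; rewrite lee_fin powR_ge0.
Qed.

End disk.

(** * The inequality *)

(** The lower bound in terms of the length [L], before it is compared with the
    energy of the unit disk. *)
Lemma W_ge (R : realType) (K : set (R * R)) (alpha : R) : C2plus K -> 0 < alpha ->
  exists2 L : R, 0 < L & Per K = L%:E /\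
    ((L * L)%:E * ((pi / L * (L / pi) `^ (- alpha))%:E * circle_energy alpha) <= W alpha K)%E.
Proof.
move=> hK al0.
have [P [Phi [k [L [[L0 rangeP] dP1 dP2 dPhi [k0 kc P_per P_inj]]]]]] := C2plus_parametrization hK.
have [[compactK cK K_interior] _] := hK.
have closedK : closed K.
  by apply: compact_closed => //; exact: norm_hausdorff.
have P_boundary x : boundary K (P x) by rewrite -rangeP; exists x.
have KP x : K (P x).
  by have [] := P_boundary x; rewrite -(closure_id _).1.
have P_not_interior x : ~ interior K (P x) by have [] := P_boundary x.
have boundary_P p : K p -> ~ interior K p -> exists x, P x = p.
  move=> Kp pI; have : boundary K p by split => //; exact: subset_closure.
  by rewrite -rangeP => -[x _ <-]; exists x.
have tge := tangent_dist_ge0_convex L0 dP1 dP2 dPhi cK KP P_not_interior k0.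
have tgt := tangent_dist_gt0_convex L0 dP1 dP2 dPhi cK KP P_not_interior boundary_P
  K_interior k0 P_per P_inj.
have turn := total_turning L0 dP1 dP2 dPhi cK KP P_not_interior boundary_P
  K_interior k0 P_per P_inj.
have nu := outward_normal_convex L0 dP1 dP2 dPhi cK KP P_not_interior boundary_P
  K_interior k0 P_per P_inj.
exists L => //; split; first exact: (Per_curve L0 dP1 dP2 dPhi k0 kc P_per tgt rangeP).
rewrite (W_curve L0 dP1 dP2 dPhi k0 kc P_per tge tgt rangeP alpha nu).
apply: lee_wpmul2l; first by rewrite lee_fin mulr_ge0// ltW.
exact: (double_integral_wkernel_ge L0 dP1 dP2 dPhi k0 P_per turn tge tgt al0).
Qed.

Unset Implicit Arguments.

Theorem proposition3p3 (R : realType) (K : set (R * R)) (alpha : R)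
  (hK : C2plus K) (halpha : 0 < alpha < 1) :
  (W alpha (closure (unit_disk R)) * (Per K * ((2 * pi)^-1)%:E) `^ (1 - alpha)
     <= W alpha K)%E /\
  (K = closure (unit_disk R) ->
   W alpha K =
   (W alpha (closure (unit_disk R)) *
     (Per K * ((2 * pi)^-1)%:E) `^ (1 - alpha))%E).
Proof.
have /andP[al0 al1] := halpha.
have p0 := pi_gt0 R.
have p2 : 0 < (2 * pi : R) by rewrite mulr_gt0.
split; last first.
  move=> ->; rewrite Per_disk -EFinM divff ?gt_eqF// poweR_EFin powR1 mule1//.
have [L L0 [PerL]] := @W_ge R K alpha hK al0.
apply: le_trans; rewrite PerL -EFinM poweR_EFin W_disk// muleAC -EFinM muleA -EFinM.
rewrite le_eqVlt; apply/orP; left; apply/eqP; congr (_%:E * _)%E.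
have -> : L / (2 * pi) = (L / pi) * 2^-1 by rewrite invfM mulrA mulrAC.
have Lpi : 0 < L / pi by rewrite divr_gt0.
rewrite powRD; last by apply/implyP => _; rewrite gt_eqF// divr_gt0.
rewrite powRr1; last by rewrite ltW// divr_gt0.
rewrite powRM ?invr_ge0// ?(ltW Lpi)//.
have -> : (2^-1 : R) `^ (- alpha) = (2 `^ (- alpha))^-1.
  by rewrite -powR_inv1// -powRrM mulN1r -powRN.
have t0 : 2 `^ (- alpha) != 0 :> R by rewrite gt_eqF// powR_gt0.
have Ln0 : L != 0 by rewrite gt_eqF.
have pn0 : (pi : R) != 0 by rewrite gt_eqF.
move: ((L / pi) `^ _) (2 `^ (- alpha)) t0 => x y y0.
by generalize (@pi R) pn0 => p pn; field; rewrite Ln0 pn y0.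
Qed.
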